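(* Let $(M,\mathcal{F})$ be a compact lamination defined by a (right) locally free action $M\times G\to M$ of a Lie group $G$ on a compact metric space $M$. If $\mathcal{F}$ admits a transverse invariant measure, then $G$ is unimodular.
   Context: The action $M\times G\to M$, $(x,g)\mapsto x.g$, is continuous and locally free (every stabilizer $G_x=\{g\in G: x.g=x\}$ is discrete). The lamination $\mathcal F$ has the orbits $x.G\cong G_x\backslash G$ as leaves. That it is a lamination means that $M$ is covered by finitely many flow boxes $U_i=T_i.B$, where $B\subset G$ is a ball centered at the identity (for a left invariant Riemannian metric on $G$), $T_i\subset M$ is a transversal, and $T_i\times B\to U_i$, $(x,g)\mapsto x.g$, is a homeomorphism. Changes of coordinates are given along plaques by left translations in $G$, and holonomy transformations are defined by the right action of $G$ on transversals. A transverse invariant measure is a nonzero measure $\nu$ on transversals, finite on compact subsets, which is invariant under holonomy, i.e. preserved by every partial Borel isomorphism between transversals whose graph is contained in the orbit equivalence relation. $G$ is unimodular if its left Haar measure is also right invariant. *)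

(* Defs.v *)
From HB Require Import structures.
From mathcomp Require Import all_boot all_order all_algebra.
From mathcomp Require Import all_classical all_reals all_analysis.
Import Order.TTheory GRing.Theory Num.Theory.
Import numFieldNormedType.Exports.

Set Implicit Arguments.
Unset Strict Implicit.
Unset Printing Implicit Defensive.

Local Open Scope classical_set_scope.
Local Open Scope ring_scope.

(* Measurable types of the library are pointed; this is the only use of the
   base point, here and in the structure of Lie groups below. *)
#[short(type="pmetricType")]
HB.structure Definition PointedMetric (R : numDomainType) :=
  {M of isPointed M & Metric R M}.

Definition homeomorphism (X Y : topologicalType) (A : set X) (B : set Y)
    (f : X -> Y) (g : Y -> X) : Prop :=
  [/\ set_fun A B f, set_fun B A g, {in A, cancel f g} & {in B, cancel g f}] /\
  {within A, continuous f} /\ {within B, continuous g}.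

Notation borel T := (g_sigma_algebraType (@open T)).

(* C^k on an open set U of a finite-dimensional space V: all iterated
   directional derivatives of order < k are differentiable on U. *)
Fixpoint Ck (R : realType) (V W : normedModType R) (k : nat) (U : set V)
    (f : V -> W) : Prop :=
  match k with
  | 0 => forall x, U x -> {for x, continuous f}
  | k'.+1 => (forall x, U x -> differentiable f x) /\
             forall v : V, Ck k' U ('D_v f)
  end.

Definition smooth_on (R : realType) (V W : normedModType R) (U : set V)
    (f : V -> W) : Prop := forall k, Ck k U f.

(* A chart from the open set chart_dom onto an open set of R^n, together with
   its inverse; the values of the two functions outside these sets are
   irrelevant. *)
Record chart (R : realType) (n : nat) (T : topologicalType) := Chart {
  chart_dom : set T;
  chart_map : T -> 'rV[R]_n;
  chart_inv : 'rV[R]_n -> T;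
  chart_img := chart_map @` chart_dom;
  chart_dom_open : open chart_dom;
  chart_img_open : open chart_img;
  chart_homeo : homeomorphism chart_dom chart_img chart_map chart_inv
}.

Definition smooth_atlas (R : realType) (n : nat) (T : topologicalType)
    (A : set (chart R n T)) : Prop :=
  \bigcup_(a in A) chart_dom a = setT /\
  forall a b, A a -> A b ->
    smooth_on (chart_map a @` (chart_dom a `&` chart_dom b))
              (chart_map b \o chart_inv a).

HB.mixin Record isLieGroup (R : realType) (n : nat) G
    of Group G & PointedTopological G := {
  lie_hausdorff : hausdorff_space G;
  lie_second_countable : @second_countable G;
  lie_mul_continuous : continuous (fun p : G * G => (p.1 * p.2)%g);
  lie_inv_continuous : continuous (fun g : G => (g^-1)%g);
  lie_atlas : set (chart R n G);
  lie_atlasP : smooth_atlas lie_atlas;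
  lie_mul_smooth : forall a b c, lie_atlas a -> lie_atlas b -> lie_atlas c ->
    smooth_on
      [set p : 'rV[R]_n * 'rV[R]_n | [/\ chart_img a p.1, chart_img b p.2
        & chart_dom c (chart_inv a p.1 * chart_inv b p.2)%g]]
      (fun p => chart_map c (chart_inv a p.1 * chart_inv b p.2)%g);
  lie_inv_smooth : forall a b, lie_atlas a -> lie_atlas b ->
    smooth_on
      [set x : 'rV[R]_n | chart_img a x /\ chart_dom b ((chart_inv a x)^-1)%g]
      (fun x => chart_map b ((chart_inv a x)^-1)%g)
}.

#[short(type="lieGroupType")]
HB.structure Definition LieGroup (R : realType) (n : nat) :=
  {G of isLieGroup R n G & Group G & PointedTopological G}.

(* A left invariant Riemannian metric on a Lie group is determined by an inner
   product on the tangent space at 1, which a chart a at 1 identifies with R^n: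
   it is given by a and by the Gram matrix Q of the inner product. *)
Section LeftInvariantMetric.
Context {R : realType} {n : nat} {G : lieGroupType R n}.

Definition inner_product (Q : 'M[R]_n) : Prop :=
  Q^T = Q /\ forall v : 'rV[R]_n, v != 0 -> 0 < (v *m Q *m v^T) 0 0.

Definition smooth_path (gamma : R -> G) : Prop :=
  continuous gamma /\
  forall a : chart R n G, lie_atlas a ->
    smooth_on (gamma @^-1` chart_dom a) (chart_map a \o gamma).

(* Norm of the velocity gamma'(t), which the left translation by gamma(t)^-1
   carries to the tangent space at 1. *)
Definition speed (a : chart R n G) (Q : 'M[R]_n) (gamma : R -> G) (t : R) : R :=
  let v := derive1 (fun s : R => chart_map a ((gamma t)^-1 * gamma s)%g) t in
  Num.sqrt ((v *m Q *m v^T) 0 0).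

Definition path_length (a : chart R n G) (Q : 'M[R]_n) (gamma : R -> G)
    : \bar R :=
  (\int[lebesgue_measure]_(t in `[0%R, 1%R]) (speed a Q gamma t)%:E)%E.

(* The points at Riemannian distance < r from 1. Paths are smooth on the whole
   line and may have zero velocity: a piecewise smooth path on [0, 1] can be
   reparametrized into such a path of the same length. *)
Definition riemannian_ball (a : chart R n G) (Q : 'M[R]_n) (r : R) : set G :=
  [set g | exists gamma : R -> G, [/\ smooth_path gamma, gamma 0 = 1%g,
    gamma 1 = g & (path_length a Q gamma < r%:E)%E]].

Definition identity_ball (B : set G) : Prop :=
  exists (a : chart R n G) (Q : 'M[R]_n) (r : R),
    [/\ lie_atlas a, chart_dom a 1%g, inner_product Q, 0 < r
      & B = riemannian_ball a Q r].

End LeftInvariantMetric.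

Section Haar.
Context {R : realType} {n : nat} (G : lieGroupType R n).

(* Finiteness on compact sets implies regularity, G being second countable. *)
Definition left_haar (mu : {measure set (borel G) -> \bar R}) : Prop :=
  [/\ (mu setT != 0)%E,
      (forall K : set G, compact K -> (mu K < +oo)%E)
    & forall (g : G) (A : set (borel G)), measurable A ->
        mu [set (g * x)%g | x in (A : set G)] = mu A].

Definition right_invariant (mu : {measure set (borel G) -> \bar R}) : Prop :=
  forall (g : G) (A : set (borel G)), measurable A ->
    mu [set (x * g)%g | x in (A : set G)] = mu A.

Definition unimodular : Prop :=
  forall mu : {measure set (borel G) -> \bar R},
    left_haar mu -> right_invariant mu.

End Haar.

Section Lamination.
Context {R : realType} {n : nat} {G : lieGroupType R n} {M : pmetricType R}.
Variable act : M -> G -> M.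

Definition right_action : Prop :=
  (forall x, act x 1%g = x) /\
  (forall x g h, act (act x g) h = act x (g * h)%g).

Definition stabilizer (x : M) : set G := [set g | act x g = x].

Definition locally_free : Prop :=
  forall x, isolated (stabilizer x) = stabilizer x.

Definition saturate (T : set M) (B : set G) : set M :=
  [set act p.1 p.2 | p in T `*` B].

Definition flow_box (T : set M) (B : set G) : Prop :=
  open (saturate T B) /\
  exists h : M -> M * G,
    homeomorphism (T `*` B) (saturate T B) (fun p => act p.1 p.2) h.

Definition lamination : Prop :=
  exists2 B : set G, identity_ball B &
  exists (k : nat) (T : 'I_k -> set M),
    (forall i, flow_box (T i) B) /\ \bigcup_i saturate (T i) B = setT.

Definition transversal (T : set M) : Prop :=
  exists2 B : set G, identity_ball B & flow_box T B.

Definition orbit_rel (x y : M) : Prop := exists g, y = act x g.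

(* f restricts to a Borel isomorphism A -> A' (with inverse h) whose graph is
   contained in the orbit equivalence relation. *)
Definition partial_holonomy (A A' : set (borel M)) (f h : borel M -> borel M)
    : Prop :=
  [/\ measurable A /\ measurable A',
      measurable_fun A f /\ measurable_fun A' h,
      set_fun A A' f /\ set_fun A' A h,
      {in A, cancel f h} /\ {in A', cancel h f}
    & forall x, A x -> orbit_rel x (f x)].

(* nu T is the measure on the transversal T; its values on sets not contained
   in T are irrelevant, as is nu T when T is not a transversal. *)
Definition transverse_invariant_measure
    (nu : set M -> {measure set (borel M) -> \bar R}) : Prop :=
  [/\ (exists2 T, transversal T & (nu T T != 0)%E),
      (forall T (K : set M), transversal T -> compact K -> K `<=` T ->
         (nu T K < +oo)%E)
    & forall T T' (A A' : set M) (f h : M -> M),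
        transversal T -> transversal T' -> A `<=` T -> A' `<=` T' ->
        partial_holonomy A A' f h ->
        forall C : set (borel M), measurable C -> C `<=` A ->
          nu T' (f @` C) = nu T C].

End Lamination.

(* Main.v *)
(* On a flow box, the transverse measure nu on the base and the left Haar
   measure lam on the plaques give a product measure. Two boxes overlap through
   holonomy maps on the bases and left translations along the plaques, which
   preserve nu and lam, so the product measures agree on overlaps and define a
   finite nonzero measure on the compact space M. Its total mass c can also be
   computed in the boxes translated by the action of g. With P_i a Borel
   partition of M into pieces of boxes with bases K_i, this says that
   s(u) = sum_i nu {x in K_i | x.u in P_i} satisfies int s(h g) dlam(h) = c for
   every g. Integrating this identity against the indicator function of
   {g | g^-1 in A} and exchanging the integrals gives c lam(A^-1) = c lam(A).
   Hence lam is invariant under inversion, and right invariant. *)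

(* The glued measure on [M] is never formed: only masses of Borel sets inside a box are defined, and
   two boxes are compared on Borel sets lying in both. The obstacle is that an orbit may meet a base
   many times, so passing from one base to another is not a single map. A point with coordinates (x,
   h) and (x', h') in two boxes satisfies x' = x.k with k = h h'^-1, and such k stay in a compact
   set. For k in a small compact set W, injectivity of flow box coordinates near 1 leaves at most
   one k for each x. This requires the plaque balls to be neighborhoods of 1, which is the fact
   extracted from the Riemannian metric. Transversals are not assumed Borel, so bases and plaques
   are cut down to compact sets: domains of holonomy maps and overlaps of boxes are then compact,
   and their measurability is automatic. *)
From HB Require Import structures.
Require Import Defs.
From mathcomp Require Import all_boot all_order all_algebra.
From mathcomp Require Import all_classical all_reals all_analysis.
From mathcomp Require Import measurable_realfun.
Import Order.TTheory GRing.Theory Num.Theory.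
Import numFieldNormedType.Exports.

Set Implicit Arguments.
Unset Strict Implicit.
Unset Printing Implicit Defensive.

Local Open Scope classical_set_scope.
Local Open Scope ring_scope.

(** * Topology and Borel sets *)

(* The complements of the sets having P would otherwise generate a proper
   filter on K without cluster points in K. *)
Lemma compact_induction (X : topologicalType) (K : set X) (P : set X -> Prop) :
  compact K -> P set0 -> (forall A B, P A -> P B -> P (A `|` B)) ->
  (forall A B, A `<=` B -> P B -> P A) ->
  (forall x, K x -> exists2 N, nbhs x N & P N) -> P K.
Proof.
move=> cK P0 PU PS PK; apply: contrapT => nPK.
pose F : set_system X := [set A | P (K `\` A)].
have FF : ProperFilter F.
  split; first by rewrite /F /= setD0.
  split.
  - by rewrite /F /= setDT.
  - by move=> A B FA FB; rewrite /F /= setDIr; exact: PU.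
  - by move=> A B AB; apply: PS; exact: setDS.
have [x [Kx]] := cK F FF ltac:(by rewrite /F /= setDv).
have [N xN PN] := PK x Kx.
move=> /(_ (~` N) N) [//| // | y []//].
by rewrite /F /= setDE setCK; apply: PS PN; exact: subIsetr.
Qed.

Lemma countable_bigcup_measurable d (T : measurableType d) (I : Type)
    (D : set I) (F : I -> set T) :
  countable D -> (forall i, D i -> measurable (F i)) ->
  measurable (\bigcup_(i in D) F i).
Proof.
move=> cD mF; rewrite bigcup_set_type; apply: countable_bigcupT_measurable.
  by rewrite (eq_countable (card_setT D)).
by move=> [i /= /set_mem]; exact: mF.
Qed.

Lemma basis_open (X : topologicalType) (B : set (set X)) (x : X) (N : set X) :
  basis B -> nbhs x N -> exists U, [/\ B U, U x & U `<=` N].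
Proof. by move=> [_ /(_ x)] h /h [U [BU Ux] UN]; exists U. Qed.

(** For each basic [U], the union [V U] of all open W with W x U inside [O] is open, and the
    countably many rectangles V U x U exhaust [O]; a countable basis of one factor is enough. *)
Lemma open_prod_measurable (X Y : ptopologicalType) (O : set (X * Y)) :
  @second_countable Y -> open O ->
  measurable (O : set (borel X * borel Y)%type).
Proof.
move=> [B cB bB] oO.
pose V (U : set Y) : set X := \bigcup_(W in [set W | open W /\ W `*` U `<=` O]) W.
have -> : O = \bigcup_(U in B) (V U `*` U).
  apply/seteqP; split=> [[x y] Oxy|[x y] [U BU [[W [oW WO] Wx] Uy]]]; last exact: WO.
  have [[P Q] [/= xP yQ] PQ] : nbhs (x, y) O by exact: open_nbhs_nbhs.
  have [U [BU Uy UQ]] := basis_open bB yQ.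
  exists U => //; split=> //=; exists P°.
    split; first exact: open_interior.
    by move=> [a b] [/= /interior_subset Pa Ub]; apply: PQ; split=> //=; exact: UQ.
  exact: xP.
apply: countable_bigcup_measurable => // U BU; apply: measurableX.
  apply: sub_sigma_algebra; apply: bigcup_open => W [oW _] //.
by apply: sub_sigma_algebra; exact: bB.1.
Qed.

Lemma measurable_prod_continuous (X Y Z : ptopologicalType) (f : X * Y -> Z) :
  @second_countable Y -> continuous f ->
  measurable_fun setT (f : borel X * borel Y -> borel Z).
Proof.
move=> cY cf; apply: (@measurability _ _ (borel X * borel Y)%type (borel Z) _ _
  (@open Z)) => // _ [A oA <-].
rewrite setTI; apply: open_prod_measurable => //.
by apply: open_comp => // x _; exact: cf.
Qed.

Lemma measurable_borel_continuous (X Y : ptopologicalType) (f : X -> Y) :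
  continuous f -> measurable_fun setT (f : borel X -> borel Y).
Proof.
move=> cf; apply: (@measurability _ _ (borel X) (borel Y) _ _ (@open Y)) => // _ [A oA <-].
rewrite setTI; apply: sub_sigma_algebra; apply: open_comp => // x _; exact: cf.
Qed.

Lemma closed_borel (X : ptopologicalType) (A : set X) :
  closed A -> measurable (A : set (borel X)).
Proof.
move=> cA; rewrite -(setCK (A : set (borel X))); apply: measurableC.
by apply: sub_sigma_algebra; exact: closed_openC.
Qed.

Lemma compact_borel (X : ptopologicalType) (A : set X) :
  hausdorff_space X -> compact A -> measurable (A : set (borel X)).
Proof. by move=> hX cA; apply: closed_borel; exact: compact_closed. Qed.

Lemma lindelof (X : ptopologicalType) (P : set X -> Prop) :
  @second_countable X -> (forall A B, A `<=` B -> P B -> P A) ->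
  (forall x : X, exists2 N, nbhs x N & P N) ->
  exists F : nat -> set X, (forall i, open (F i) /\ P (F i)) /\
    \bigcup_i F i = setT.
Proof.
move=> [B cB bB] PS PN; pose D := [set U | B U /\ P U].
have DX x : exists2 U, D U & U x.
  have [N xN PN'] := PN x; have [U [BU Ux UN]] := basis_open bB xN.
  by exists U => //; split=> //; exact: PS PN'.
have cD : countable D by apply: sub_countable cB; apply: subset_card_le => U [].
case/pfcard_geP: cD => [D0|[f]].
  by have [U] := DX point; rewrite D0.
have fD i : D (f i) by exact: funS.
exists f; split=> [i|]; first by split; [exact: bB.1 (fD i).1|exact: (fD i).2].
apply/seteqP; split=> // x _; have [U DU Ux] := DX x.
by have [i _ fi] := @surj _ _ _ _ f U DU; exists i => //; rewrite fi.
Qed.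

(** * Haar measures *)

Section LieTopology.
Context {R : realType} {n : nat} {G : lieGroupType R n}.
Implicit Types (g h : G) (A : set G).

Lemma continuous_lie_mul (T : topologicalType) (u v : T -> G) :
  continuous u -> continuous v -> continuous (fun x => u x * v x)%g.
Proof.
move=> cu cv x; apply: (@continuous_comp _ _ _ (fun x => (u x, v x))
  (fun p : G * G => (p.1 * p.2)%g)); last exact: lie_mul_continuous.
by apply: cvg_pair; [exact: cu|exact: cv].
Qed.

Lemma lie_lmul_continuous g : continuous (fun h => g * h)%g.
Proof. by apply: continuous_lie_mul => [x|x]; [exact: cvg_cst|exact: cvg_id]. Qed.

Lemma lie_rmul_continuous g : continuous (fun h => h * g)%g.
Proof. by apply: continuous_lie_mul => [x|x]; [exact: cvg_id|exact: cvg_cst]. Qed.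

Lemma image_lmul g A : [set (g * x)%g | x in A] = (fun x => g^-1 * x)%g @^-1` A.
Proof.
apply/seteqP; split=> [_ [x Ax <-]|x Ax] /=; first by rewrite mulgA mulVg mul1g.
by exists (g^-1 * x)%g => //; rewrite mulgA mulgV mul1g.
Qed.

Lemma image_rmul g A : [set (x * g)%g | x in A] = (fun x => x * g^-1)%g @^-1` A.
Proof.
apply/seteqP; split=> [_ [x Ax <-]|x Ax] /=; first by rewrite -mulgA mulgV mulg1.
by exists (x * g^-1)%g => //; rewrite -mulgA mulVg mulg1.
Qed.

Lemma nbhs_lmul g A : nbhs 1%g A -> nbhs g [set (g * x)%g | x in A].
Proof.
move=> A1; rewrite image_lmul; have := @lie_lmul_continuous (g^-1)%g g.
by rewrite /continuous_at mulVg; apply.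
Qed.

Lemma lie_chart g : exists2 a : chart R n G, lie_atlas a & chart_dom a g.
Proof.
have [a aA ga] : (\bigcup_(a in lie_atlas) chart_dom a) g.
  by rewrite (@lie_atlasP R n G).1.
by exists a.
Qed.

Variable a : chart R n G.

Lemma chart_mapK : {in chart_dom a, cancel (chart_map a) (chart_inv a)}.
Proof. by have [[]] := chart_homeo a. Qed.

Lemma chart_invK : {in chart_img a, cancel (chart_inv a) (chart_map a)}.
Proof. by have [[]] := chart_homeo a. Qed.

Lemma chart_inv_dom x : chart_img a x -> chart_dom a (chart_inv a x).
Proof. by have [[_ h _ _] _] := chart_homeo a; exact: h. Qed.

Lemma chart_map_img g : chart_dom a g -> chart_img a (chart_map a g).
Proof. by exists g. Qed.

Lemma chart_map_continuous g : chart_dom a g -> {for g, continuous (chart_map a)}.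
Proof.
have [_ [+ _]] := chart_homeo a.
by rewrite (continuous_open_subspace _ (@chart_dom_open _ _ _ a)) => h ag; exact/h/mem_set.
Qed.

Lemma chart_inv_continuous x : chart_img a x -> {for x, continuous (chart_inv a)}.
Proof.
have [_ [_ +]] := chart_homeo a.
by rewrite (continuous_open_subspace _ (@chart_img_open _ _ _ a)) => h ag; exact/h/mem_set.
Qed.

End LieTopology.

(** Closed balls of R^n, brought to [G] by the inverse of a chart, are the compact neighborhoods. *)
Lemma lie_locally_compact (R : realType) (n : nat) (G : lieGroupType R n)
    (g : G) (A : set G) : nbhs g A ->
  exists2 K, nbhs g K & compact K /\ K `<=` A.
Proof.
move=> gA; have [a _ ag] := lie_chart g.
pose x := chart_map a g.
have ax : chart_img a x by exact: chart_map_img.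
have gE : chart_inv a x = g by apply: chart_mapK; exact/mem_set.
have : nbhs x (chart_img a `&` chart_inv a @^-1` A).
  apply: filterI; first by apply: open_nbhs_nbhs; split=> //; exact: chart_img_open.
  by apply: (chart_inv_continuous ax); rewrite gE.
move=> /nbhs_closedballP[r rA].
exists (chart_inv a @` closed_ball x r%:num); last split.
- have : nbhs g (chart_dom a `&` chart_map a @^-1` closed_ball x r%:num).
    apply: filterI.
      by apply: open_nbhs_nbhs; split=> //; exact: chart_dom_open.
    by apply: (chart_map_continuous ag); by apply/nbhs_closedballP; exists r.
  apply: filterS => h [ah rh]; exists (chart_map a h) => //.
  by apply: chart_mapK; exact/mem_set.
- apply: continuous_compact.
    apply: continuous_in_subspaceT => y /set_mem /rA[ay _].
    exact: chart_inv_continuous.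
  apply: bounded_closed_compact; last exact: closed_ball_closed.
  exists (`|x| + r%:num); split; first exact: num_real.
  move=> M rM y /=; rewrite closed_ballE // /closed_ball_ /= => xyr.
  apply/ltW/(le_lt_trans _ rM); rewrite -lerBlDl.
  by apply: le_trans xyr; rewrite distrC; exact: lerB_dist.
- by move=> _ [y /rA[_ Ay] <-].
Qed.

Section Haar.
Context {R : realType} {n : nat} {G : lieGroupType R n}.
Variable mu : {measure set (borel G) -> \bar R}.
Hypothesis muP : left_haar mu.
Local Notation GG := (borel G).

Lemma measurable_lie_mul :
  measurable_fun setT (fun p : GG * GG => (p.1 * p.2)%g : GG).
Proof.
exact: (@measurable_prod_continuous G G G _ lie_second_countable (@lie_mul_continuous R n G)).
Qed.

Lemma measurable_lie_inv : measurable_fun setT (fun g : GG => g^-1%g : GG).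
Proof. exact: (@measurable_borel_continuous G G _ (@lie_inv_continuous R n G)). Qed.

Lemma haar_lmul (g : GG) (A : set GG) : measurable A ->
  mu ((fun x => g * x)%g @^-1` A) = mu A.
Proof.
move=> mA; have [_ _ /(_ g^-1%g A mA)] := muP.
by rewrite image_lmul invgK.
Qed.

Lemma haar_integral_lmul (g : GG) (f : GG -> \bar R) : measurable_fun setT f ->
  (forall x, 0 <= f x)%E ->
  (\int[mu]_x f (g * x)%g = \int[mu]_x f x)%E.
Proof.
move=> mf f0.
have mg : measurable_fun setT (fun x : GG => (g * x)%g : GG).
  exact: (@measurable_borel_continuous G G _ (@lie_lmul_continuous R n G g)).
have := @ge0_integral_pushforward _ _ _ _ R _ mg mu setT f measurableT mf
  (fun x _ => f0 x).
rewrite preimage_setT => <-; apply: eq_measure_integral => A mA _.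
exact: haar_lmul.
Qed.

Lemma haar_sigma_finite : sigma_finite setT mu.
Proof.
have [_ cmu _] := muP.
pose P (A : set G) := exists2 K, compact K & A `<=` K.
have [A B AB [K cK BK]|g|F [FP FT]] := @lindelof G P lie_second_countable.
- by exists K => //; apply: subset_trans BK.
- have [K gK [cK _]] := lie_locally_compact (@filterT _ (nbhs g) _).
  by exists K => //; exists K.
exists F => [|i]; first by rewrite FT.
have [oF [K cK FK]] := FP i.
have mF : measurable (F i : set GG) by exact: sub_sigma_algebra.
split=> //; apply: le_lt_trans (cmu K cK); apply: le_measure; rewrite ?inE //.
by apply: compact_borel => //; exact: lie_hausdorff.
Qed.

(** Otherwise countably many open subsets of translates of [A], all of them null, would cover
    [G]. *)
Lemma haar_nbhs_neq0 (A : set GG) : measurable A -> nbhs (1%g : G) A ->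
  mu A != 0%E.
Proof.
move=> mA A1; apply/negP => /eqP A0; have [/negP mu0 _ _] := muP; apply: mu0.
pose P (U : set G) := exists g : G, U `<=` [set (g * x)%g | x in (A : set G)].
have [U V UV [g Vg]|g|F [FP FT]] := @lindelof G P lie_second_countable.
- by exists g; apply: subset_trans Vg.
- by exists [set (g * x)%g | x in (A : set G)]; [exact: nbhs_lmul|exists g].
have mF i : measurable (F i : set GG) by apply: sub_sigma_algebra; exact: (FP i).1.
have F0 i : mu (F i) = 0%E.
  have [_ [g Fg]] := FP i.
  apply/eqP; rewrite -measure_le0.
  have [_ _ /(_ g A mA)] := muP; rewrite A0 => <-.
  apply: le_measure => //; rewrite inE //.
  rewrite image_lmul -[X in measurable X]setTI.
  exact: (@measurable_borel_continuous G G _ (@lie_lmul_continuous R n G _)).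
rewrite -measure_le0 -FT.
apply: le_trans (measure_sigma_subadditive mu mF _ (@subset_refl _ _)) _.
  exact: bigcup_measurable.
by rewrite eseries0.
Qed.

(** Tonelli's theorem asks for a sigma-finite measure structure. The underlying measure is still
    [mu], so statements pass between the two by conversion. *)
Definition sigma_finite_haar : {sigma_finite_measure set GG -> \bar R} :=
  HB.pack (Measure.sort mu)
    (isSFinite.Build _ _ _ _ (sfinite_measure_sigma_finite haar_sigma_finite))
    (isSigmaFinite.Build _ _ _ _ haar_sigma_finite) (Measure.on mu).

End Haar.

(** * Haar measure and inversion *)

Section HaarInversion.
Context {R : realType} {n : nat} {G : lieGroupType R n}.
Variable mu : {sigma_finite_measure set (borel G) -> \bar R}.
Hypothesis muP : left_haar mu.
Local Notation GG := (borel G).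

Lemma haar_inv (s : GG -> \bar R) (c : R) (A : set GG) :
  measurable_fun setT s -> (forall x, 0 <= s x)%E -> 0 < c ->
  (forall g : GG, \int[mu]_h s (h * g)%g = c%:E)%E -> measurable A ->
  mu ((fun g => g^-1%g) @^-1` A) = mu A.
Proof.
move=> ms s0 c0 sc mA.
have mmul := @measurable_lie_mul R n G.
have minv := @measurable_lie_inv R n G.
have mx : measurable_fun setT (fst : GG * GG -> GG) by exact: measurable_fst.
have my : measurable_fun setT (snd : GG * GG -> GG) by exact: measurable_snd.
have mix : measurable_fun setT (fun p : GG * GG => p.1^-1%g : GG).
  exact: measurableT_comp minv mx.
have m1 d (T : measurableType d) (f : T -> GG) : measurable_fun setT f ->
    measurable_fun setT (fun x => (\1_A (f x) : R)%:E).
  move=> mf; apply/measurable_EFinP.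
  by apply: (measurableT_comp (measurable_indic mA)).
have i1 (g : GG) : (\int[mu]_h (\1_A (g^-1 * h)%g)%:E = mu A)%E.
  rewrite (@haar_integral_lmul _ _ _ mu muP g^-1%g (fun x => (\1_A x)%:E)) //.
    by rewrite integral_indic // setIT.
  exact: m1.
pose k1 (p : GG * GG) := ((\1_A (p.1^-1)%g)%:E * s (p.2 * p.1)%g)%E.
pose k2 (p : GG * GG) := ((\1_A (p.1^-1 * p.2)%g)%:E * s p.1)%E.
have mk1 : measurable_fun setT k1.
  apply: emeasurable_funM; first exact: m1.
  apply: (measurableT_comp ms).
  exact: (measurableT_comp mmul (measurable_fun_pair my mx)).
have mk2 : measurable_fun setT k2.
  apply: emeasurable_funM; last exact: measurableT_comp.
  apply: m1; exact: (measurableT_comp mmul (measurable_fun_pair mix my)).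
have k10 p : (0 <= k1 p)%E by rewrite mule_ge0 // lee_fin.
have k20 p : (0 <= k2 p)%E by rewrite mule_ge0 // lee_fin.
have mrow (g : GG) : measurable_fun setT (fun h : GG => (h * g)%g : GG).
  exact: (@measurable_borel_continuous G G _ (@lie_rmul_continuous R n G g)).
have mlow (g : GG) : measurable_fun setT (fun h : GG => (g * h)%g : GG).
  exact: (@measurable_borel_continuous G G _ (@lie_lmul_continuous R n G g)).
have E1 : (\int[mu]_g \int[mu]_h k1 (g, h) = c%:E * mu ((fun g => g^-1%g) @^-1` A))%E.
  under eq_integral => g _.
    rewrite /k1 /= ge0_integralZl ?lee_fin //; last first.
      exact: (measurableT_comp ms (mrow g)).
    rewrite sc muleC.
    over.
  rewrite ge0_integralZl //; last by rewrite lee_fin ltW.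
    rewrite -[fun x => _]/(fun x => (\1_((fun g : GG => g^-1%g) @^-1` A) x)%:E).
    rewrite integral_indic // ?setIT //.
    by rewrite -[X in measurable X]setTI; exact: minv.
  exact: m1.
have E2 : (\int[mu]_g \int[mu]_h k2 (g, h) = mu A * c%:E)%E.
  under eq_integral => g _.
    rewrite /k2 /= ge0_integralZr //; last exact: (m1 _ _ _ (mlow g^-1%g)).
    rewrite i1.
    over.
  rewrite ge0_integralZl // -(sc 1%g); congr (_ * _)%E.
  by apply: eq_integral => g _; rewrite mulg1.
(* For fixed h, k2 (h g, h) = k1 (g, h) because (h g)^-1 h = g^-1. Left invariance in the first
   variable, placed between two exchanges of integrals, therefore joins the two sides. *)
have E3 : (\int[mu]_g \int[mu]_h k1 (g, h) = \int[mu]_g \int[mu]_h k2 (g, h))%E.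
  have F1 := @fubini_tonelli _ _ _ _ _ mu mu k1 mk1 k10.
  have F2 := @fubini_tonelli _ _ _ _ _ mu mu k2 mk2 k20.
  apply: (etrans F1); apply: (etrans _ (esym F2)); apply: eq_integral => h _.
  have L := @haar_integral_lmul _ _ _ mu muP h (fun x => k2 (x, h))
    (measurableT_comp mk2 (pair2_measurable h)) (fun x => k20 (x, h)).
  apply: (etrans _ L); apply: eq_integral => g _.
  by rewrite /k1 /k2 /= invgM -mulgA mulVg mulg1.
move: E3; rewrite E1 E2 muleC => /(congr1 (fun x => x * (c^-1)%:E)%E).
by rewrite -!muleA -EFinM mulfV ?gt_eqF// !mule1.
Qed.

(* Right translation by g is inversion, left translation by g^-1, inversion. *)
Lemma haar_right_invariant :
  (forall A : set GG, measurable A -> mu ((fun g => g^-1%g) @^-1` A) = mu A) ->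
  right_invariant mu.
Proof.
move=> muV g A mA; have [_ _ muL] := muP.
have minv := @measurable_lie_inv R n G.
have mAV : measurable ((fun g : GG => g^-1%g : GG) @^-1` A).
  by rewrite -[X in measurable X]setTI; exact: minv.
rewrite -[RHS]muV // -[RHS](@haar_lmul _ _ _ _ muP g) // -[RHS]muV.
  congr (mu _); rewrite image_rmul; apply/seteqP; split=> x /=;
  by rewrite invgM invgK.
by rewrite -[X in measurable X]setTI;
  exact: (@measurable_borel_continuous G G _ (@lie_lmul_continuous R n G g)).
Qed.

End HaarInversion.

(** * Riemannian balls are neighborhoods of the identity *)

Lemma derive_line (R : realType) (W : normedModType R) (f : R -> W) (x v : R) :
  differentiable f x -> 'D_v f x = v *: 'D_1 f x.
Proof.
move=> df; rewrite !deriveE //; rewrite -[X in 'd f x X](mulr1 v).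
by rewrite -[v * 1]/(v *: (1 : R)) linearZ.
Qed.

(** * Differential calculus along the line and along sine arcs *)

Section CkLine.
Context {R : realType} {W : normedModType R}.
Implicit Types (U : set R) (phi : R -> R) (f g : R -> W).

Lemma der_scale phi f (x : R) : differentiable phi x -> differentiable f x ->
  (fun h => h^-1 *: (((fun t => phi t *: f t) \o shift x) (h *: 1) - phi x *: f x))
    @ 0^' --> phi x *: 'D_1 f x + 'D_1 phi x *: f x.
Proof.
move=> dphi df.
have -> : (fun h : R => h^-1 *: (((fun t => phi t *: f t) \o shift x) (h *: 1)
      - phi x *: f x)) =
    (fun h => phi (h + x) *: (h^-1 *: ((f \o shift x) (h *: 1) - f x)) +
       (h^-1 *: ((phi \o shift x) (h *: 1) - phi x)) *: f x).
  apply/funext => h /=; rewrite [h *: 1]mulr1 scalerA [phi _ * _]mulrC -scalerA.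
  rewrite -[(_ *: (phi _ - _)) *: _]scalerA -scalerDr; congr (_ *: _).
  by rewrite scalerBr scalerBl addrA subrK.
apply: cvgD; apply: cvgZ.
- have := differentiable_continuous dphi; rewrite /continuous_at => cphi.
  have hx : (h + x) @[h --> (0 : R)^'] --> x.
    rewrite -[X in _ --> X](add0r x); apply: cvgD; last exact: cvg_cst.
    exact: nbhs_dnbhs.
  exact: cvg_comp hx cphi.
- by apply: (@diff_derivable _ _ _ f x 1).
- by apply: (@diff_derivable _ _ _ phi x 1).
- exact: cvg_cst.
Qed.

Lemma differentiable_scale phi f (x : R) : differentiable phi x ->
  differentiable f x -> differentiable (fun t => phi t *: f t) x.
Proof.
move=> dphi df; apply/derivable1_diffP; apply/cvg_ex.
by eexists; exact: der_scale.
Qed.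

Lemma derive_scale phi f (x v : R) : differentiable phi x -> differentiable f x ->
  'D_v (fun t => phi t *: f t) x = phi x *: 'D_v f x + 'D_v phi x *: f x.
Proof.
move=> dphi df; rewrite derive_line; last exact: differentiable_scale.
have E : 'D_1 (fun t => phi t *: f t) x = _ :=
  cvg_lim (@norm_hausdorff _ _) (der_scale dphi df).
rewrite (derive_line v df) (derive_line v dphi) E.
by rewrite scalerDr !scalerA [v * phi x]mulrC.
Qed.

(** The formulas for derivatives hold only at points of [U], whereas [Ck] speaks of functions on the
    whole line; openness makes the derivatives on [U] depend on the values on [U] alone. *)
Lemma Ck_ext k U f g : open U -> (forall x, U x -> f x = g x) ->
  Ck k U f -> Ck k U g.
Proof.
move=> oU; elim: k f g => [|k IHk] f g fg /=.
  move=> cf x Ux; suff : g y @[y --> x] --> f x by rewrite (fg x Ux).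
  apply: cvg_trans (cf x Ux); apply: near_eq_cvg.
  exact: (filterS fg (open_nbhs_nbhs (conj oU Ux))).
have fgx x : U x -> {near x, f =1 g}.
  by move=> Ux; exact: (filterS fg (open_nbhs_nbhs (conj oU Ux))).
move=> [df Df]; split=> [x Ux|v].
  by apply/derivable1_diffP; apply: near_eq_derivable (fgx x Ux) _;
    exact/derivable1_diffP/df.
by apply: IHk (Df v) => x Ux; exact: near_eq_derive (fgx x Ux).
Qed.

Lemma Ck_le k U f : Ck k.+1 U f -> Ck k U f.
Proof.
elim: k f => [|k IHk] f /= [df Df].
  by move=> x Ux; exact/differentiable_continuous/df.
by split=> // v; exact/IHk/Df.
Qed.

Lemma Ck_add k U f g : open U -> Ck k U f -> Ck k U g -> Ck k U (f + g).
Proof.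
move=> oU; elim: k f g => [|k IHk] f g /=.
  by move=> cf cg x Ux; apply: cvgD; [exact: cf|exact: cg].
move=> [df Df] [dg Dg]; split=> [x Ux|v].
  by apply: differentiableD; [exact: df|exact: dg].
apply: Ck_ext oU _ (IHk _ _ (Df v) (Dg v)) => x Ux /=.
by rewrite deriveD //; apply: diff_derivable; [exact: df|exact: dg].
Qed.

(** The multiplier is smooth of every order so that ['D_v phi] can take its place in the induction;
    in that term [f] is needed only to the lower order. *)
Lemma Ck_scale k U phi f : open U -> smooth_on U phi -> Ck k U f ->
  Ck k U (fun t => phi t *: f t).
Proof.
move=> oU; elim: k phi f => [|k IHk] phi f sphi /=.
  by move=> cf x Ux; apply: cvgZ; [exact: (sphi 0%N)|exact: cf].
move=> [df Df]; have [dphi _] := sphi 1%N; split=> [x Ux|v].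
  by apply: differentiable_scale; [exact: dphi|exact: df].
have Dphi : smooth_on U ('D_v phi) by move=> j; exact: (sphi j.+1).2.
apply: (@Ck_ext k U ((fun t => phi t *: 'D_v f t) + (fun t => 'D_v phi t *: f t))) => //.
  by move=> x Ux /=; rewrite derive_scale //; [exact: dphi|exact: df].
apply: Ck_add => //; first exact: IHk.
by apply: IHk => //; apply: (@Ck_le k U f); split.
Qed.

End CkLine.

Lemma differentiable_sin (R : realType) (t : R) : differentiable (sin : R -> R) t.
Proof. by apply/derivable1_diffP; have [] := is_derive_sin t. Qed.

Lemma differentiable_cos (R : realType) (t : R) : differentiable (cos : R -> R) t.
Proof. by apply/derivable1_diffP; have [] := is_derive_cos t. Qed.

Lemma derive_sin (R : realType) (t v : R) : 'D_v (sin : R -> R) t = v * cos t.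
Proof.
by rewrite derive_line; [have [_ ->] := is_derive_sin t|exact: differentiable_sin].
Qed.

Lemma derive_cos (R : realType) (t v : R) : 'D_v (cos : R -> R) t = - (v * sin t).
Proof.
rewrite derive_line; last exact: differentiable_cos.
by have [_ ->] := is_derive_cos t; rewrite scalerN.
Qed.

(** Combinations of sine and cosine are closed under differentiation, so the induction runs over all
    coefficients at once. *)
Lemma trig_smooth (R : realType) (U : set R) (a b : R) :
  smooth_on U (fun t : R => a * sin t + b * cos t).
Proof.
have df (a' b' x : R) : differentiable (fun t : R => a' * sin t + b' * cos t) x.
  apply: (@differentiableD _ _ _ (a' *: sin) (b' *: cos));
  by apply: differentiableZ; first [exact: differentiable_sin|exact: differentiable_cos].
move=> k; elim: k a b => [|k IHk] a b /=.
  by move=> x _; exact: differentiable_continuous.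
split=> // v.
have -> : 'D_v (fun t : R => a * sin t + b * cos t) =
    (fun t : R => - (v * b) * sin t + v * a * cos t).
  apply/funext => t.
  rewrite [LHS](@deriveD _ _ _ (a *: sin) (b *: cos)); try
    by apply: diff_derivable; apply: differentiableZ;
      first [exact: differentiable_sin|exact: differentiable_cos].
  rewrite !deriveZ; try by apply: diff_derivable;
      first [exact: differentiable_sin|exact: differentiable_cos].
  rewrite derive_sin derive_cos addrC; congr (_ + _).
    by rewrite -[LHS]/(b * - (v * sin t)) mulrN mulNr mulrCA mulrA.
  by rewrite -[LHS]/(a * (v * cos t)) mulrCA mulrA.
exact: IHk.
Qed.

Section SineArc.
Context {R : realType} {V : normedModType R}.
Variables (p v : V).

(* Smooth paths are defined on the whole line: a sine arc never leaves a small
   ball around p, and reaches p + sin 1 *: v at time 1. *)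
Definition sine_arc (t : R) : V := p + sin t *: v.

Lemma differentiable_sine_arc (t : R) : differentiable sine_arc t.
Proof.
apply: (@differentiableD _ _ _ (cst p) (fun s => sin s *: v)) => //.
exact/differentiableZl/differentiable_sin.
Qed.

Lemma diff_sine_arc (t u : R) : 'd sine_arc t u = (u * cos t) *: v.
Proof.
have -> : sine_arc = cst p + (fun s => sin s *: v) by [].
rewrite diffD //; last exact/differentiableZl/differentiable_sin.
rewrite /= diff_cst /= add0r diffZl; last exact: differentiable_sin.
by rewrite -deriveE ?derive_sin //; exact: differentiable_sin.
Qed.

(** The derivative along the arc is u cos t times the derivative of [F] in the constant direction
    [v]. Iteration thus stays within multiples of iterated derivatives in one direction, and no
    higher order chain rule is involved. *)
Lemma Ck_sine_arc (W : normedModType R) k (U : set V) (F : V -> W) :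
  open (sine_arc @^-1` U) -> Ck k U F -> Ck k (sine_arc @^-1` U) (F \o sine_arc).
Proof.
move=> oU; elim: k F => [|k IHk] F /=.
  move=> cF x Ux; apply: (@continuous_comp _ _ _ sine_arc F); last exact: (cF _ Ux).
  exact/differentiable_continuous/differentiable_sine_arc.
move=> [dF DF]; split=> [x Ux|u].
  by apply: differentiable_comp; [exact: differentiable_sine_arc|exact: (dF _ Ux)].
(* The zero sine term gives the multiplier the shape of [trig_smooth]. *)
apply: (@Ck_ext R W k _ (fun t => (0 * sin t + u * cos t) *: 'D_v F (sine_arc t)) _ oU).
  move=> x Ux /=; rewrite mul0r add0r.
  have dFx := dF _ Ux; have dx := differentiable_sine_arc x.
  rewrite [RHS]deriveE; last exact: differentiable_comp.
  rewrite diff_comp // /= diff_sine_arc linearZ /=.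
  by rewrite deriveE.
by apply: Ck_scale => //; [exact: trig_smooth|exact: (IHk _ (DF v))].
Qed.

End SineArc.

(** The integral of a nonnegative function is a supremum over the simple functions below it, so
    monotonicity holds without measurability. This bounds path lengths without any study of the
    measurability of [speed]. *)
Lemma ge0_le_integral_nomeas d (T : measurableType d) (R : realType)
    (mu : {measure set T -> \bar R}) (D : set T) (f g : T -> \bar R) :
  (forall x, D x -> 0 <= f x)%E -> (forall x, D x -> f x <= g x)%E ->
  (\int[mu]_(x in D) f x <= \int[mu]_(x in D) g x)%E.
Proof.
move=> f0 fg; have g0 x : D x -> (0 <= g x)%E.
  by move=> Dx; exact: le_trans (f0 x Dx) (fg x Dx).
rewrite !ge0_integralE //; apply: ereal_sup_le => _ [h hf <-].
exists h => // x; apply: le_trans (hf x) _.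
by rewrite /patch; case: ifPn => // /set_mem; exact: fg.
Qed.

Lemma cvg_sumr (R : realType) (V : normedModType R) (T I : Type)
    (F : set_system T) {FF : Filter F} (r : seq I) (f : I -> T -> V) (l : I -> V) :
  (forall i, f i x @[x --> F] --> l i) ->
  (\sum_(i <- r) f i x) @[x --> F] --> \sum_(i <- r) l i.
Proof.
move=> fl; elim: r => [|i r IH].
  by rewrite big_nil; under eq_fun do rewrite big_nil; exact: cvg_cst.
by rewrite big_cons; under eq_fun do rewrite big_cons; exact: cvgD.
Qed.

(** * Speed of short arcs near the identity *)

Section SmallSpeed.
Context {R : realType} {n : nat} {G : lieGroupType R n}.
Local Notation E := 'rV[R]_n.

Lemma quadratic_form_continuous (Q : 'M[R]_n) :
  continuous (fun v : E => (v *m Q *m v^T) 0 0).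
Proof.
have -> : (fun v : E => (v *m Q *m v^T) 0 0) =
    (fun v : E => \sum_j (\sum_i v 0 i * Q i j) * v 0 j).
  by apply/funext => v; rewrite mxE; apply: eq_bigr => j _; rewrite !mxE.
move=> v; apply: (@cvg_sumr R _ E _ (nbhs v) _) => j.
apply: cvgM; last exact: coord_continuous.
apply: (@cvg_sumr R _ E _ (nbhs v) _) => i.
by apply: cvgM; [exact: coord_continuous|exact: cvg_cst].
Qed.

Variables (a : chart R n G) (Q : 'M[R]_n).
Hypotheses (aA : lie_atlas a) (a1 : chart_dom a 1%g).
Let p := chart_map a 1%g.
Let m (z : E * E) := chart_map a (chart_inv a z.1 * chart_inv a z.2)%g.
Let y (x : E) := chart_map a ((chart_inv a x)^-1)%g.
Let S := [set z : E * E | [/\ chart_img a z.1, chart_img a z.2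
        & chart_dom a (chart_inv a z.1 * chart_inv a z.2)%g]].

Let pimg : chart_img a p. Proof. exact: chart_map_img. Qed.

Let invp : chart_inv a p = 1%g.
Proof. by apply: chart_mapK; exact/mem_set. Qed.

Let Spp : S (p, p).
Proof. by split => //=; rewrite invp mulg1. Qed.

Let smooth_m : smooth_on S m.
Proof. exact: lie_mul_smooth. Qed.

Let inv_continuous : {for p, continuous (fun x => (chart_inv a x)^-1)%g}.
Proof.
exact: (cvg_comp _ _ (chart_inv_continuous pimg)
  (@lie_inv_continuous R n G (chart_inv a p))).
Qed.

Let y_continuous : {for p, continuous y}.
Proof.
apply: (@continuous_comp _ _ _ (fun x => (chart_inv a x)^-1)%g (chart_map a)).
  exact: inv_continuous.
by apply: chart_map_continuous; rewrite invp invg1.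
Qed.

Let yp : y p = p. Proof. by rewrite /y invp invg1. Qed.

(* The velocity of a sine arc at x with Euclidean velocity w, pulled back to
   the tangent space at 1. *)
Let vel (xw : E * E) : E :=
  \sum_i xw.2 0 i *: 'D_((0, delta_mx 0 i) : E * E) m (y xw.1, xw.1).

(** [Ck] yields continuity of the derivative of [m] in each fixed direction, not of its
    differential; expanding the velocity in the standard basis turns this into joint continuity in
    position and velocity at (p, 0). *)
Let vel_continuous : vel xw @[xw --> (p, 0 : E)] --> (0 : E).
Proof.
have : vel xw @[xw --> (p, 0 : E)] -->
    \sum_i (0 : E) 0 i *: 'D_((0, delta_mx 0 i) : E * E) m (p, p).
  rewrite /vel.
  apply: (@cvg_sumr R _ _ _ (nbhs (p, 0 : E)) _) => i; apply: cvgZ.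
    apply: (@cvg_comp _ _ _ snd (fun w : E => w 0 i) _ (nbhs (0 : E))).
      exact: cvg_snd.
    exact: (@coord_continuous R 1 n 0 i 0).
  have [_ /(_ (0, delta_mx 0 i)) /= cD] := smooth_m 1%N.
  have zc : (y xw.1, xw.1) @[xw --> (p, 0 : E)] --> ((p, p) : E * E).
    have yc : y xw.1 @[xw --> (p, 0 : E)] --> p.
      apply: (@cvg_comp _ _ _ fst y _ (nbhs p)); first exact: cvg_fst.
      by have : y x @[x --> p] --> y p := y_continuous; rewrite yp.
    exact: (@cvg_pair _ _ _ (nbhs (p, 0 : E)) (nbhs p) (nbhs p) _ _ _
      (fun xw => y xw.1) fst yc cvg_fst).
  exact: (cvg_comp _ _ zc (cD _ Spp)).
have -> : \sum_i (0 : E) 0 i *: 'D_((0, delta_mx 0 i) : E * E) m (p, p) = 0.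
  by rewrite big1 // => i _; rewrite mxE scale0r.
by [].
Qed.

Lemma speed_sine_arc (v : E) (t : R) :
  (forall s, chart_img a (sine_arc p v s)) ->
  chart_dom a ((chart_inv a (sine_arc p v t))^-1)%g ->
  speed a Q (chart_inv a \o sine_arc p v) t =
    Num.sqrt ((fun w => (w *m Q *m w^T) 0 0) (vel (sine_arc p v t, cos t *: v))).
Proof.
move=> cimg yt; rewrite /speed; set w := derive1 _ _.
suff -> : w = vel (sine_arc p v t, cos t *: v) by [].
rewrite {}/w; set c := sine_arc p v.
have invy : chart_inv a (y (c t)) = (chart_inv a (c t))^-1%g.
  by apply: chart_mapK; exact/mem_set.
(* At fixed [t], translating back to 1 is multiplication by the element with coordinates [y (c t)],
   so only the second argument of [m] moves. *)
have -> : (fun s : R => chart_map a (((chart_inv a \o c) t)^-1 * (chart_inv a \o c) s)%g)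
    = m \o (fun s => (y (c t), c s)).
  by apply/funext => s; rewrite /m /= invy.
have Sc : S (y (c t), c t).
  split => /=; [exact: chart_map_img|exact: cimg|].
  by rewrite invy mulVg.
have [dm _] := smooth_m 1%N.
have dc : differentiable (fun s : R => (y (c t), c s)) t.
  by apply: differentiable_pair => //; exact: differentiable_sine_arc.
rewrite derive1E'; last by apply: differentiable_comp => //; exact: dm.
set w := cos t *: v.
have dE : 'd (fun s : R => (y (c t), c s)) t 1 = (0, w) :> E * E.
  have := @diff_pair _ _ _ _ (cst (y (c t))) c t
    (@differentiable_cst _ _ _ _ _) (differentiable_sine_arc p v t).
  move=> /(congr1 (fun F => F 1)) H; apply: (etrans H); congr (_, _).
    by rewrite diff_cst.
  by rewrite diff_sine_arc mul1r.
have -> : 'd (m \o (fun s : R => (y (c t), c s))) t 1 = 'd m (y (c t), c t) (0, w).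
  have := diff_comp dc (dm _ Sc).
  move=> /(congr1 (fun F => F 1)) H; apply: (etrans H).
  exact: (congr1 ('d m (y (c t), c t)) dE).
transitivity (\sum_i 'd m (y (c t), c t) (w 0 i *: ((0, delta_mx 0 i) : E * E))).
  rewrite -linear_sum; congr ('d m _ _).
  rewrite {1}[w]row_sum_delta.
  rewrite [RHS]surjective_pairing; congr (_, _).
    by rewrite (big_morph fst (id1 := 0) (op1 := +%R)) // big1 // => i _; rewrite /= scaler0.
  by rewrite (big_morph snd (id1 := 0) (op1 := +%R)).
by apply: eq_bigr => i _; rewrite linearZ /= deriveE //; exact: dm.
Qed.

(** One neighborhood of (p, 0) has to serve all times [t]: as sine and cosine are bounded by 1, an
    arc with small [v] has all its positions near [p] and all its velocities near 0. *)
Lemma speed_sine_arc_small (e : R) : 0 < e ->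
  \forall xw \near (p, 0 : E), forall v t, (forall s, chart_img a (sine_arc p v s)) ->
    xw = (sine_arc p v t, cos t *: v) ->
    speed a Q (chart_inv a \o sine_arc p v) t <= e.
Proof.
move=> e0.
have q0 : ((vel xw *m Q *m (vel xw)^T) 0 0) @[xw --> (p, 0 : E)] --> (0 : R).
  have -> : (0 : R) = ((0 : E) *m Q *m (0 : E)^T) 0 0 by rewrite !mul0mx mxE.
  exact: (cvg_comp _ _ vel_continuous (@quadratic_form_continuous Q 0)).
have qe : \forall xw \near (p, 0 : E), (vel xw *m Q *m (vel xw)^T) 0 0 < e ^+ 2.
  by apply: (cvgr_lt _ q0); rewrite exprn_gt0.
have dy : \forall xw \near (p, 0 : E), chart_dom a ((chart_inv a xw.1)^-1)%g.
  have dx : \forall x \near p, chart_dom a ((chart_inv a x)^-1)%g.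
    apply: inv_continuous; apply: open_nbhs_nbhs.
    by split; [exact: (@chart_dom_open _ _ _ a)|rewrite invp invg1].
  exact: (@cvg_fst _ _ (nbhs p) (nbhs (0 : E)) _ _ dx).
apply: filterS2 qe dy => xw q dx v t cimg xwE; rewrite xwE in q dx.
rewrite speed_sine_arc //.
by apply: (le_trans (ler_wsqrtr (ltW q))); rewrite sqrtr_sqr gtr0_norm.
Qed.

End SmallSpeed.

(** A point near 1 is the end of a sine arc from 1 of speed at most r / 2 during the unit time
    interval; halving [r] makes the length strictly smaller than [r]. *)
Lemma identity_ball_nbhs (R : realType) (n : nat) (G : lieGroupType R n)
  (B : set G) : identity_ball B -> nbhs (1%g : G) B.
Proof.
move=> [a [Q [r [aA a1 Qp r0 ->]]]].
pose p := chart_map a 1%g.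
have invp : chart_inv a p = 1%g by apply: chart_mapK; exact/mem_set.
have r20 : 0 < r / 2 by rewrite divr_gt0.
have := speed_sine_arc_small Q aA a1 r20; rewrite -/p.
move=> [[N1 N2] /= [N1p N20] NS].
have imgp : nbhs p (chart_img a).
  apply: open_nbhs_nbhs; split; first exact: (@chart_img_open _ _ _ a).
  exact: chart_map_img.
have /nbhs_ballP[d /= d0 dN1] : nbhs p (N1 `&` chart_img a) by exact: filterI.
have /nbhs_ballP[d' /= d'0 dN2] := N20.
pose e := Num.min d d'.
have e0 : 0 < e by rewrite lt_min d0.
have s1 : 0 < sin (1 : R).
  by apply: sin_gt0_pi; rewrite ltr01 /=; apply: lt_le_trans (pi_ge2 R); rewrite ltr1n.
have : nbhs (1%g : G) (chart_dom a `&` chart_map a @^-1` ball p (e * sin 1)).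
  apply: filterI.
    by apply: open_nbhs_nbhs; split=> //; exact: (@chart_dom_open _ _ _ a).
  by apply: (chart_map_continuous a1); apply: nbhsx_ballx; rewrite mulr_gt0.
apply: filterS => g [ag]; rewrite /= mx_norm_ball /ball_ /= => pg.
(* Division by [sin 1] makes the arc reach [g] at time 1, and the radius [e * sin 1] is chosen to
   give [v] norm less than [e]. *)
pose v : 'rV[R]_n := (sin 1)^-1 *: (chart_map a g - p).
have ve : `|v| < e.
  rewrite normrZ normfV (gtr0_norm s1) mulrC ltr_pdivrMr //.
  by rewrite distrC.
have small c : `|c| <= 1 -> `|c *: v| < e.
  by move=> c1; rewrite normrZ; apply: le_lt_trans ve; rewrite ler_piMl.
have sin1 t : `|sin t| <= 1 :> R by rewrite ler_norml sin_geN1 sin_le1.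
have cos1 t : `|cos t| <= 1 :> R by rewrite ler_norml cos_geN1 cos_le1.
have arcN t : (N1 `&` chart_img a) (sine_arc p v t).
  apply: dN1; rewrite /= mx_norm_ball /ball_ /= /sine_arc opprD addrA subrr sub0r normrN.
  by apply: lt_le_trans (small _ (sin1 t)) _; rewrite ge_min lexx.
have cimg t : chart_img a (sine_arc p v t) by have [] := arcN t.
have arc1 : sine_arc p v 1 = chart_map a g.
  by rewrite /sine_arc /v scalerA mulfV ?gt_eqF // scale1r addrC subrK.
pose gamma := chart_inv a \o sine_arc p v.
have cgamma : continuous gamma.
  move=> t; apply: (@continuous_comp _ _ _ (sine_arc p v) (chart_inv a)).
    exact/differentiable_continuous/differentiable_sine_arc.
  exact: chart_inv_continuous.
exists gamma; split.
- split=> // b bA k.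
  (* In the chart [b] the path is the arc followed by a transition map of the atlas, which is smooth
     on [U]. *)
  pose U := chart_map a @` (chart_dom a `&` chart_dom b).
  have UE : gamma @^-1` chart_dom b = sine_arc p v @^-1` U.
    apply/seteqP; split=> [t bt|t [h [ah bh] hE]].
      exists (gamma t); first by split=> //; exact: chart_inv_dom.
      by apply: chart_invK; exact/mem_set.
    by rewrite /gamma /= -hE chart_mapK //; exact/mem_set.
  have oU : open (gamma @^-1` chart_dom b).
    by apply: open_comp => [t _|]; [exact: cgamma|exact: (@chart_dom_open _ _ _ b)].
  rewrite UE in oU *.
  apply: (@Ck_sine_arc _ _ _ _ _ _ _ (chart_map b \o chart_inv a)) => //.
  by apply: (@lie_atlasP R n G).2.
- by rewrite /gamma /= /sine_arc sin0 scale0r addr0.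
- by rewrite /gamma /= arc1; apply: chart_mapK; exact/mem_set.
- rewrite /path_length.
  have le : (\int[lebesgue_measure]_(t in `[0%R, 1%R]) (speed a Q gamma t)%:E <=
      \int[lebesgue_measure]_(t in `[0%R, 1%R]) (cst (r / 2)%:E) t)%E.
    apply: ge0_le_integral_nomeas => t _; first by rewrite lee_fin sqrtr_ge0.
    rewrite lee_fin.
    apply: (NS (sine_arc p v t, cos t *: v)) => //; split => /=.
      by have [] := arcN t.
    apply: dN2; rewrite /= mx_norm_ball /ball_ /= sub0r normrN.
    by apply: lt_le_trans (small _ (cos1 t)) _; rewrite ge_min lexx orbT.
  apply: le_lt_trans le _; rewrite integral_cst //= lebesgue_measure_itv /=.
  by rewrite lte_fin ltr01 sube0 mule1 lte_fin ltr_pdivrMr // ltr_pMr // ltr1n.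
Qed.

(** * Holonomy and measures of boxes *)

(** Holonomy is controlled only on its domain, whereas a push-forward takes a global map: [f] is
    extended by the base point off [A], and [mu] is restricted to [A]. *)
Lemma integral_transport d d' (X : measurableType d) (Y : measurableType d')
    (R : realType) (mu : {measure set X -> \bar R}) (mu' : {measure set Y -> \bar R})
    (A : set X) (A' : set Y) (f : X -> Y) (phi : Y -> \bar R) :
  measurable A -> measurable A' -> measurable_fun A f -> set_fun A A' f ->
  (forall D, measurable D -> D `<=` A' -> mu' D = mu (A `&` f @^-1` D)) ->
  measurable_fun A' phi -> (forall y, A' y -> 0 <= phi y)%E ->
  (\int[mu']_(y in A') phi y = \int[mu]_(x in A) phi (f x))%E.
Proof.
move=> mA mA' mf fAA' muE mphi phi0.
pose F := fun x => if x \in A then f x else point.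
have mF : measurable_fun setT F.
  exact: (measurable_restrictT (fun x => f x) mA).1.
pose m : {measure set X -> \bar R} := mrestr mu mA.
have FA x : A x -> F x = f x by move=> Ax; rewrite /F mem_set.
pose D := F @^-1` A'.
have mD : measurable D by rewrite -[D]setTI; exact: mF.
have AD : A `<=` D by move=> x Ax; rewrite /D /= FA //; exact: fAA'.
have E1 : (\int[mu']_(y in A') phi y = \int[pushforward m F]_(y in A') phi y)%E.
  apply: eq_measure_integral => P mP PA'.
  rewrite muE // /pushforward /m /= /mrestr; congr (mu _).
  apply/seteqP; split=> x.
    by move=> [Ax fx]; split=> //=; rewrite FA.
  by move=> [/= Fx Ax]; split=> //=; rewrite -FA.
have phi0' : {in A', forall y, (0 <= phi y)%E} by move=> y /set_mem; exact: phi0.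
rewrite E1 (ge0_integral_pushforward mF m mA' mphi phi0').
have mDphi : measurable_fun D (phi \o F).
  by apply: (measurable_comp mA') => //; [move=> _ [x Dx <-]|exact: measurable_funTS].
(* The extension may send points outside [A] into [A']; they form D \ A, which [m] does not
   charge. *)
have -> : F @^-1` A' = A `|` (D `\` A) by rewrite setDUK.
rewrite ge0_integral_setU //; first last.
- by apply/disj_setPS => x [Ax [_ nAx]].
- by move=> x; rewrite setDUK // => Dx; exact: phi0.
- by rewrite setDUK.
- exact: measurableD.
rewrite [X in (_ + X)%E]null_set_integral ?adde0 //; first last.
- by rewrite /m /= /mrestr setDE -setIA setICl setI0 measure0.
- by apply: measurable_funS mDphi => //; exact: subDsetl.
- exact: measurableD.
rewrite (eq_measure_integral mu); last first.
  by move=> P mP PA; rewrite /m /= /mrestr setIidl.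
by apply: eq_integral => x /set_mem Ax; rewrite /= FA.
Qed.

Section Holonomy.
Context {R : realType} {n : nat} {G : lieGroupType R n} {M : pmetricType R}.
Variable act : M -> G -> M.
Hypothesis actP : right_action act.
Hypothesis act_continuous : continuous (fun p : M * G => act p.1 p.2).

Implicit Types (T K : set M) (W B C : set G).

Lemma act1 x : act x 1%g = x. Proof. exact: actP.1. Qed.
Lemma actM x g h : act (act x g) h = act x (g * h)%g. Proof. exact: actP.2. Qed.

Lemma actK x g : act (act x g) g^-1%g = x.
Proof. by rewrite actM mulgV act1. Qed.

Definition act_injective (T : set M) (B : set G) : Prop :=
  forall x y g h, T x -> T y -> B g -> B h -> act x g = act y h -> x = y /\ g = h.

Lemma flow_box_injective T B : flow_box act T B -> act_injective T B.
Proof.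
move=> [_ [h [[_ _ hK _] _]]] x y g k Tx Ty Bg Bk e.
have K1 := hK (x, g) (mem_set (conj Tx Bg)).
by have := hK (y, k) (mem_set (conj Ty Bk)); rewrite /= -e K1 => -[].
Qed.

Lemma transversal_injective T : Defs.transversal act T ->
  exists2 B, nbhs (1%g : G) B & act_injective T B.
Proof.
by move=> [B /identity_ball_nbhs B1 TB]; exists B => //; exact: flow_box_injective.
Qed.

Definition holonomy_graph (K K' : set M) (W : set G) : set (M * G) :=
  [set p | [/\ K p.1, W p.2 & K' (act p.1 p.2)]].

Definition holonomy_dom K K' W : set M := fst @` holonomy_graph K K' W.

(** The default 1 is met only outside [holonomy_dom]; on the domain, [unique_holonomy] makes the
    choice canonical. *)
Definition holonomy_elt (K' : set M) (W : set G) (x : M) : G :=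
  xget 1%g [set k | W k /\ K' (act x k)].

Definition holonomy K' W (x : M) : M := act x (holonomy_elt K' W x).

Lemma holonomy_graph_compact K K' W : compact K -> closed K' -> compact W ->
  compact (holonomy_graph K K' W).
Proof.
move=> cK cK' cW.
have -> : holonomy_graph K K' W = (K `*` W) `&` (fun p => act p.1 p.2) @^-1` K'.
  by apply/seteqP; split=> -[x k] /=; [case|case=> -[]].
apply: compact_closedI; first exact: compact_setX.
by apply: preimage_closed => // p _; exact: act_continuous.
Qed.

Lemma holonomy_dom_compact K K' W : compact K -> closed K' -> compact W ->
  compact (holonomy_dom K K' W).
Proof.
move=> cK cK' cW; apply: continuous_compact; last exact: holonomy_graph_compact.
by apply: continuous_subspaceT => p; exact: cvg_fst.
Qed.

Lemma holonomy_domP K K' W x : holonomy_dom K K' W x ->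
  [/\ K x, W (holonomy_elt K' W x) & K' (holonomy K' W x)].
Proof.
move=> [[x' k] /= [Kx Wk K'x] <-]; split=> //;
by have [] := @xgetPex _ 1%g [set k | W k /\ K' (act x' k)] (ex_intro _ k (conj Wk K'x)).
Qed.

Definition unique_holonomy K K' W :=
  forall x k k', K x -> W k -> W k' -> K' (act x k) -> K' (act x k') -> k = k'.

Lemma holonomy_eltE K K' W x k : unique_holonomy K K' W -> K x -> W k ->
  K' (act x k) -> holonomy_elt K' W x = k.
Proof.
move=> u Kx Wk K'k; have [|_ W1 K1] := @holonomy_domP K K' W x.
  by exists (x, k).
exact: u K1 K'k.
Qed.

(** If x.k and x.k' lie in [T'], then x.k' has the coordinates (x.k, k^-1 k') and also (x.k', 1);
    injectivity on T' x B' equates them. *)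
Lemma unique_holonomyP T' B' K K' W : act_injective T' B' -> B' 1%g ->
  K' `<=` T' -> (forall k k', W k -> W k' -> B' (k^-1 * k')%g) ->
  unique_holonomy K K' W.
Proof.
move=> injT' B1 KT' WB x k k' Kx Wk Wk' K1 K2.
have [_ /(congr1 (fun g => k * g)%g)] : act x k = act x k' /\ (k^-1 * k')%g = 1%g.
  apply: injT'; [exact: KT'|exact: KT'|exact: WB|exact: B1|].
  by rewrite actM act1 mulgA mulgV mul1g.
by rewrite mulgA mulgV mul1g mulg1.
Qed.

(** By uniqueness, a point of the domain lands in an open [U] exactly when it is outside the domain
    of the holonomy into K' \ U, and both domains are compact. *)
Lemma holonomy_measurable K K' W : compact K -> compact K' -> compact W ->
  unique_holonomy K K' W ->
  measurable_fun (holonomy_dom K K' W : set (borel M))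
    (holonomy K' W : borel M -> borel M).
Proof.
move=> cK cK' cW u.
have hM : hausdorff_space M := @metric_hausdorff R M.
have clK' := compact_closed hM cK'.
have mA : measurable (holonomy_dom K K' W : set (borel M)).
  by apply: compact_borel => //; exact: holonomy_dom_compact.
apply: (@measurability _ _ (borel M) (borel M) _ _ (@open M)) => // _ [U oU <-].
have -> : holonomy_dom K K' W `&` holonomy K' W @^-1` U =
    holonomy_dom K K' W `\` holonomy_dom K (K' `&` ~` U) W.
  apply/seteqP; split=> x [Ax b]; split=> //.
    move=> [[x' k] /= [Kx Wk [K'k nO]] xE]; subst x'; apply: nO.
    by rewrite -(holonomy_eltE u Kx Wk K'k).
  apply: contrapT => /= nO; apply: (b : ~ _).
  have [Kx Wk K'k] := holonomy_domP Ax.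
  by exists (x, holonomy_elt K' W x).
apply: measurableD => //; apply: compact_borel => //.
apply: holonomy_dom_compact => //; apply: closedI => //.
exact: open_closedC.
Qed.

Definition set_invg (W : set G) : set G := [set k | W k^-1%g].

Lemma set_invgK : involutive set_invg.
Proof. by move=> W; apply/funext => k; rewrite /set_invg /= invgK. Qed.

Lemma set_invg_compact W : compact W -> compact (set_invg W).
Proof.
move=> cW; have -> : set_invg W = [set k^-1%g | k in W].
  apply/seteqP; split=> [k Wk|_ [k Wk <-]]; last by rewrite /set_invg /= invgK.
  by exists k^-1%g => //; rewrite invgK.
apply: continuous_compact cW; apply: continuous_subspaceT.
exact: (@lie_inv_continuous R n G).
Qed.

Lemma holonomyK K K' W x : unique_holonomy K' K (set_invg W) ->
  holonomy_dom K K' W x ->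
  holonomy_dom K' K (set_invg W) (holonomy K' W x) /\
  holonomy K (set_invg W) (holonomy K' W x) = x.
Proof.
move=> u Ax; have [Kx Wk K'k] := holonomy_domP Ax.
set k := holonomy_elt K' W x in Wk.
have WVk : set_invg W k^-1%g by rewrite /set_invg /= invgK.
have xE : act (holonomy K' W x) k^-1%g = x by exact: actK.
split; first by exists (holonomy K' W x, k^-1%g) => //; split=> //=; rewrite xE.
by rewrite {1}/holonomy (holonomy_eltE u K'k WVk) xE.
Qed.

Lemma holonomy_partial K K' W : compact K -> compact K' -> compact W ->
  unique_holonomy K K' W -> unique_holonomy K' K (set_invg W) ->
  partial_holonomy act (holonomy_dom K K' W) (holonomy_dom K' K (set_invg W))
    (holonomy K' W) (holonomy K (set_invg W)).
Proof.
move=> cK cK' cW u u'.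
have hM : hausdorff_space M := @metric_hausdorff R M.
have cWV := set_invg_compact cW.
have inv x : holonomy_dom K' K (set_invg W) x ->
    holonomy_dom K K' W (holonomy K (set_invg W) x) /\
    holonomy K' W (holonomy K (set_invg W) x) = x.
  by move=> Ax; have := @holonomyK K' K (set_invg W) x; rewrite set_invgK; apply.
split.
- split; apply: compact_borel => //; apply: holonomy_dom_compact => //;
  exact: compact_closed.
- by split; exact: holonomy_measurable.
- by split=> x Ax; [exact: (holonomyK u' Ax).1|exact: (inv _ Ax).1].
- by split=> x /set_mem Ax; [exact: (holonomyK u' Ax).2|exact: (inv _ Ax).2].
- by move=> x _; exists (holonomy_elt K' W x).
Qed.

End Holonomy.

(** * Mass of a Borel set in a box *)

Section BoxMass.
Context {R : realType} {n : nat} {G : lieGroupType R n} {M : pmetricType R}.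
Variable act : M -> G -> M.
Hypothesis actP : right_action act.
Hypothesis act_continuous : continuous (fun p : M * G => act p.1 p.2).
Variable nu : set M -> {measure set (borel M) -> \bar R}.
Hypothesis nuP : transverse_invariant_measure act nu.
Variable lam : {sigma_finite_measure set (borel G) -> \bar R}.
Hypothesis lamP : left_haar lam.
Implicit Types (T K E : set M) (W B C : set G).

(** [T] is kept because [nu] is indexed by transversals, while integration takes place on the
    compact base [K]. The plaque [C] is not tied to a ball at 1: it will be translated by arbitrary
    elements of [G], and injectivity survives this. *)
Record is_box T K C : Prop := IsBox {
  box_transversal : Defs.transversal act T;
  box_base_sub : K `<=` T;
  box_base_compact : compact K;
  box_plaque_compact : compact C;
  box_injective : act_injective act K C
}.

Definition box_section K C E (x : M) : set (borel G) :=
  [set h | [/\ K x, C h & E (act x h)]].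

(** The product of [nu T] and [lam] in box coordinates, with the plaque variable integrated
    first. *)
Definition box_mass T K C E : \bar R :=
  (\int[nu T]_(x in K) lam (box_section K C E x))%E.

Let hausM : hausdorff_space M. Proof. exact: (@metric_hausdorff R M). Qed.
Let hausG : hausdorff_space G. Proof. exact: lie_hausdorff. Qed.

Lemma measurable_act :
  measurable_fun setT (fun p : borel M * borel G => act p.1 p.2 : borel M).
Proof. exact: (@measurable_prod_continuous M G M _ lie_second_countable act_continuous). Qed.

Lemma measurable_box_set K C E : compact K -> compact C ->
  measurable (E : set (borel M)) ->
  measurable ([set p | [/\ K p.1, C p.2 & E (act p.1 p.2)]] :
    set (borel M * borel G)).
Proof.
move=> cK cC mE.
have -> : [set p : borel M * borel G | [/\ K p.1, C p.2 & E (act p.1 p.2)]] =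
    (K `*` C) `&` (fun p : borel M * borel G => act p.1 p.2 : borel M) @^-1` E.
  by apply/seteqP; split=> -[x k] /=; [case|case=> -[]].
apply: measurableI.
  by apply: measurableX; exact: compact_borel.
by rewrite -[X in measurable X]setTI; exact: measurable_act.
Qed.

Lemma box_sectionE K C E x : box_section K C E x =
  xsection [set p : borel M * borel G | [/\ K p.1, C p.2 & E (act p.1 p.2)]] x.
Proof. by apply/seteqP; split=> h; rewrite xsectionP. Qed.

Lemma measurable_box_section K C E x : compact K -> compact C ->
  measurable (E : set (borel M)) -> measurable (box_section K C E x).
Proof.
move=> cK cC mE; rewrite box_sectionE; apply: measurable_xsection.
exact: measurable_box_set.
Qed.

Lemma measurable_box_density K C E : compact K -> compact C ->
  measurable (E : set (borel M)) ->
  measurable_fun setT (fun x : borel M => lam (box_section K C E x)).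
Proof.
move=> cK cC mE; have := measurable_fun_xsection lam (measurable_box_set cK cC mE).
by congr (measurable_fun _ _); apply/funext => x; rewrite box_sectionE.
Qed.

Lemma box_mass_ge0 T K C E : (0 <= box_mass T K C E)%E.
Proof. by apply: integral_ge0 => x _; exact: measure_ge0. Qed.

Lemma box_mass0 T K C : box_mass T K C set0 = 0%E.
Proof.
apply: integral0_eq => x _; rewrite (_ : box_section _ _ _ _ = set0) ?measure0 //.
by apply/seteqP; split=> // h [].
Qed.

Lemma box_mass_sum T K C E (I : Type) (s : seq I) (P : I -> set M) :
  compact K -> compact C -> (forall i, measurable (P i : set (borel M))) ->
  (forall x, (lam (box_section K C E x) =
     \sum_(i <- s) lam (box_section K C (P i) x))%E) ->
  (box_mass T K C E = \sum_(i <- s) box_mass T K C (P i))%E.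
Proof.
move=> cK cC mP EP; rewrite /box_mass -ge0_integral_sum //.
- by apply: eq_integral => x _; rewrite EP.
- exact: (compact_borel hausM).
- by move=> i; apply: measurable_funTS; exact: measurable_box_density.
Qed.

Lemma box_mass_split T K C E Q : compact K -> compact C ->
  measurable (E : set (borel M)) -> measurable (Q : set (borel M)) ->
  (box_mass T K C E = box_mass T K C (E `&` Q) + box_mass T K C (E `\` Q))%E.
Proof.
move=> cK cC mE mQ.
have mEQ : measurable (E `&` Q : set (borel M)) by exact: measurableI.
have mEnQ : measurable (E `\` Q : set (borel M)) by exact: measurableD.
rewrite /box_mass -ge0_integralD //.
- apply: eq_integral => x _; rewrite -measureU.
  + congr (lam _); apply/seteqP; split=> h.
      by move=> [Kx Ch Eh]; have [Qh|nQh] := pselect (Q (act x h)); [left|right].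
    by move=> [[Kx Ch []]|[Kx Ch []]].
  + exact: measurable_box_section.
  + exact: measurable_box_section.
  + by apply/seteqP; split=> // h [[_ _ []]] _ Qh [_ _ []].
- exact: (compact_borel hausM).
- by apply: measurable_funTS; exact: measurable_box_density.
- by apply: measurable_funTS; exact: measurable_box_density.
Qed.

(** The part of the overlap of two boxes where coordinates (x, h) become (x.k, k^-1 h) for some k in
    [W]. For compact data it is compact, hence a Borel set along which to cut. *)
Definition box_transition K C K' C' W : set M :=
  [set act p.1.1 p.1.2 | p in [set p : M * G * G |
     [/\ K p.1.1, C p.1.2, W p.2, K' (act p.1.1 p.2) & C' (p.2^-1 * p.1.2)%g]]].

Lemma box_transition_compact K C K' C' W :
  compact K -> compact C -> compact K' -> compact C' -> compact W ->
  compact (box_transition K C K' C' W).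
Proof.
move=> cK cC cK' cC' cW; apply: continuous_compact.
  apply: continuous_subspaceT => p.
  apply: (@continuous_comp _ _ _ (fun p : M * G * G => p.1) (fun p => act p.1 p.2)).
    exact: cvg_fst.
  exact: act_continuous.
have -> : [set p : M * G * G | [/\ K p.1.1, C p.1.2, W p.2, K' (act p.1.1 p.2)
    & C' (p.2^-1 * p.1.2)%g]] = ((K `*` C) `*` W) `&`
   ((fun p : M * G * G => act p.1.1 p.2) @^-1` K' `&`
    (fun p : M * G * G => (p.2^-1 * p.1.2)%g) @^-1` C').
  apply/seteqP; split=> -[[x h] k] /=; first by case.
  by case=> -[[? ?] ?] [].
have c1 : continuous (fun p : M * G * G => p.1.1).
  move=> p; apply: (@continuous_comp _ _ _ (fun p : M * G * G => p.1) fst).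
    exact: cvg_fst.
  exact: cvg_fst.
have c2 : continuous (fun p : M * G * G => p.1.2).
  move=> p; apply: (@continuous_comp _ _ _ (fun p : M * G * G => p.1) snd).
    exact: cvg_fst.
  exact: cvg_snd.
have c3 : continuous (fun p : M * G * G => p.2) by move=> p; exact: cvg_snd.
apply: compact_closedI; first by apply: compact_setX => //; exact: compact_setX.
apply: closedI; apply: preimage_closed; try exact: compact_closed.
- move=> p _; apply: (@continuous_comp _ _ _ (fun p : M * G * G => (p.1.1, p.2))
    (fun p => act p.1 p.2)); last exact: act_continuous.
  by apply: cvg_pair; [exact: c1|exact: c3].
- move=> p _; apply: continuous_lie_mul => //= q.
  apply: (@continuous_comp _ _ _ (fun p : M * G * G => p.2) (fun g : G => g^-1)%g).
    exact: c3.
  exact: lie_inv_continuous.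
Qed.

(* Integrating over the domain A of a holonomy map instead of K is harmless
   because the sections of E vanish outside A. *)
Lemma box_mass_dom T K C E (A : set M) : compact K ->
  A `<=` K -> (forall x h, K x -> C h -> E (act x h) -> A x) ->
  box_mass T K C E = (\int[nu T]_(x in A) lam (box_section K C E x))%E.
Proof.
move=> cK AK EA; rewrite /box_mass.
have -> : A = K `&` A by rewrite setIidr.
rewrite integral_mkcondr; apply: eq_integral => x _.
rewrite /patch; case: ifPn => // /negP nA.
rewrite (_ : box_section K C E x = set0) ?measure0 //.
apply/seteqP; split=> // h [Kx Ch Eh]; apply: nA; apply/mem_set.
exact: EA Eh.
Qed.

(** The quotients k^-1 k' control the map from [K] to [K'], and the quotients k k'^-1 the map back:
    both have to be single-valued for the invariance of [nu] to apply. *)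
Lemma box_mass_holonomy T K C T' K' C' B B' W E :
  is_box T K C -> is_box T' K' C' ->
  act_injective act T B -> B 1%g -> act_injective act T' B' -> B' 1%g ->
  compact W ->
  (forall k k', W k -> W k' -> B (k * k'^-1)%g) ->
  (forall k k', W k -> W k' -> B' (k^-1 * k')%g) ->
  measurable (E : set (borel M)) -> E `<=` box_transition K C K' C' W ->
  box_mass T K C E = box_mass T' K' C' E.
Proof.
move=> [tT KT cK cC injK] [tT' KT' cK' cC' injK'] injT B1 injT' B1' cW WB WB' mE EQ.
have u : unique_holonomy act K K' W by exact: (unique_holonomyP actP injT' B1' KT' WB').
have u' : unique_holonomy act K' K (set_invg W).
  apply: (unique_holonomyP actP injT B1 KT) => k k' Wk Wk'.
  by have := WB _ _ Wk Wk'; rewrite invgK.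
have clK := compact_closed hausM cK; have clK' := compact_closed hausM cK'.
pose A := holonomy_dom act K K' W; pose A' := holonomy_dom act K' K (set_invg W).
pose f := holonomy act K' W.
have cA : compact A by exact: holonomy_dom_compact.
have cA' : compact A' by apply: holonomy_dom_compact => //; exact: set_invg_compact.
have AK : A `<=` K by move=> x /holonomy_domP[].
have AK' : A' `<=` K' by move=> x /holonomy_domP[].
have holP := holonomy_partial actP act_continuous cK cK' cW u u'.
(* A point of E determines its coordinates in both boxes and the element of W
   relating them. *)
have EW x h : K x -> C h -> E (act x h) ->
    exists k, [/\ W k, K' (act x k) & C' (k^-1 * h)%g].
  move=> Kx Ch /EQ[[[x1 h1] k1] /= [Kx1 Ch1 Wk1 K'1 C'1] e].
  have [e1 e2] := injK _ _ _ _ Kx1 Kx Ch1 Ch e; subst x1 h1.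
  by exists k1.
have EW' x' h' : K' x' -> C' h' -> E (act x' h') ->
    exists k, [/\ W k, K (act x' k^-1%g) & C (k * h')%g].
  move=> Kx' Ch' /EQ[[[x1 h1] k1] /= [Kx1 Ch1 Wk1 K'1 C'1] e].
  have [|e1 e2] := injK' (act x1 k1) x' (k1^-1 * h1)%g h' K'1 Kx' C'1 Ch'.
    by rewrite (actM actP) mulgA mulgV mul1g.
  exists k1; subst x' h'; split=> //; first by rewrite (actK actP).
  by rewrite mulgA mulgV mul1g.
rewrite (@box_mass_dom T K C E A) //; last first.
  by move=> x h Kx Ch Eh; have [k [Wk K'k _]] := EW x h Kx Ch Eh; exists (x, k).
rewrite (@box_mass_dom T' K' C' E A') //; last first.
  move=> x h Kx Ch Eh; have [k [Wk K'k _]] := EW' x h Kx Ch Eh.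
  by exists (x, k^-1%g) => //; split=> //=; rewrite /set_invg /= invgK.
have [_ _ nuH] := nuP.
have [[mA mA'] [mf mh] [fAA' hAA'] [fK hK] _] := holP.
rewrite (@integral_transport _ _ _ _ _ (nu T) (nu T') A A' f); first last.
- by move=> y _; exact: measure_ge0.
- by apply: measurable_funTS; exact: measurable_box_density.
- move=> D mD DA'.
  have mAD : measurable (A `&` f @^-1` D : set (borel M)) by exact: mf.
  have := nuH T T' A A' f (holonomy act K (set_invg W)) tT tT'
    (subset_trans AK KT) (subset_trans AK' KT') holP _ mAD (@subIsetl _ _ _).
  (* Invariance speaks of images and [integral_transport] of preimages; they agree because [f] maps
     [A] onto [A']. *)
  move=> <-; congr (nu T' _); apply/seteqP; split=> [y Dy|_ [x [Ax Dx] <-] //].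
  have A'y := DA' _ Dy; have hKy := hK y (mem_set A'y).
  exists (holonomy act K (set_invg W) y); last exact: hKy.
  by split; [exact: hAA'|rewrite /f /= hKy].
- exact: fAA'.
- exact: mf.
- exact: mA'.
- exact: mA.
apply: eq_integral => x /set_mem Ax.
have [Kx Wk K'k] := holonomy_domP Ax.
set k := holonomy_elt act K' W x in Wk.
have fE : f x = act x k by [].
(* Only the element k of [W] attached to [x] can relate the two coordinates of a point of [E] over
   [x], so the two sections differ by the left translation by k. *)
have -> : box_section K' C' E (f x) =
    (fun h' => k * h')%g @^-1` box_section K C E x.
  apply/seteqP; split=> h' /=.
    move=> [K'f C'h' Eh']; have Ex : E (act x (k * h')%g).
      by rewrite -(actM actP) -fE.
    split=> //.
    have [k1 [Wk1 K1 C1]] := EW' _ _ K'f C'h' Eh'.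
    suff -> : k = k1 by [].
    apply: (can_inj invgK); apply: (u' (f x)) => //=.
    - by rewrite /set_invg /= invgK.
    - by rewrite /set_invg /= invgK.
    - by rewrite fE (actK actP).
  move=> [_ Ch Ekh]; have [k1 [Wk1 K1 C1]] := EW _ _ Kx Ch Ekh.
  have kk : k1 = k by exact: (u x).
  split=> //; last by rewrite fE (actM actP).
  by move: C1; rewrite kk mulgA mulVg mul1g.
by rewrite (haar_lmul lamP) //; exact: measurable_box_section.
Qed.

End BoxMass.

Lemma lie_small_nbhs (R : realType) (n : nat) (G : lieGroupType R n)
    (f : G * G -> G) (g : G) (B : set G) : continuous f -> f (g, g) = 1%g ->
  nbhs (1%g : G) B ->
  exists2 N, nbhs g N & forall k k', N k -> N k' -> B (f (k, k')).
Proof.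
move=> cf fg B1; have := cf (g, g) B; rewrite fg => /(_ B1).
move=> [[N1 N2] /= [gN1 gN2] NB]; exists (N1 `&` N2); first exact: filterI.
by move=> k k' [N1k _] [_ N2k']; apply: (NB (k, k')).
Qed.

(** * Independence of the mass from the box *)

Section BoxMassEq.
Context {R : realType} {n : nat} {G : lieGroupType R n} {M : pmetricType R}.
Variable act : M -> G -> M.
Hypothesis actP : right_action act.
Hypothesis act_continuous : continuous (fun p : M * G => act p.1 p.2).
Variable nu : set M -> {measure set (borel M) -> \bar R}.
Hypothesis nuP : transverse_invariant_measure act nu.
Variable lam : {sigma_finite_measure set (borel G) -> \bar R}.
Hypothesis lamP : left_haar lam.
Implicit Types (T K E : set M) (W B C : set G).

Let hausM : hausdorff_space M. Proof. exact: (@metric_hausdorff R M). Qed.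
Let hausG : hausdorff_space G. Proof. exact: lie_hausdorff. Qed.
Local Notation box_mass := (box_mass act nu lam).

(** The elements h h'^-1 relating the two coordinates of points of [E] lie in the compact set C
    C'^-1, which finitely many sets small enough for [box_mass_holonomy] cover. *)
Lemma box_mass_eq T K C T' K' C' E : is_box act T K C -> is_box act T' K' C' ->
  measurable (E : set (borel M)) ->
  E `<=` saturate act K C -> E `<=` saturate act K' C' ->
  box_mass T K C E = box_mass T' K' C' E.
Proof.
move=> b b' mE EKC EKC'.
have [tT KT cK cC injK] := b; have [tT' KT' cK' cC' injK'] := b'.
have [B B1 injT] := transversal_injective tT.
have [B' B1' injT'] := transversal_injective tT'.
have c1 : continuous (fst : G * G -> G) by move=> p; exact: cvg_fst.
have c2 : continuous (snd : G * G -> G) by move=> p; exact: cvg_snd.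
have cV (f : G * G -> G) : continuous f -> continuous (fun p => (f p)^-1)%g.
  move=> cf p; apply: (@continuous_comp _ _ _ f (fun g : G => g^-1)%g).
    exact: cf.
  exact: lie_inv_continuous.
have cD1 : continuous (fun p : G * G => p.1 * p.2^-1)%g.
  by apply: continuous_lie_mul => //; exact: cV.
have cD2 : continuous (fun p : G * G => p.1^-1 * p.2)%g.
  by apply: continuous_lie_mul => //; exact: cV.
pose Q := box_transition act K C K' C'.
(* The larger set [D'] makes the property monotone, as [compact_induction] requires: the transition
   set of an arbitrary subset need not be Borel. *)
pose P (D : set G) := exists D' : set G, [/\ D `<=` D', measurable (Q D' : set (borel M)) &
  forall F, measurable (F : set (borel M)) -> F `<=` Q D' ->
    box_mass T K C F = box_mass T' K' C' F].
pose D := [set (p.1 * p.2^-1)%g | p in C `*` C'].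
have cD : compact D.
  apply: continuous_compact; last exact: compact_setX.
  exact: continuous_subspaceT.
have Q0 : Q set0 = set0 by apply/seteqP; split=> // z [[[x h] k] /= []].
have : P D.
  apply: compact_induction cD _ _ _ _.
  - exists set0; rewrite Q0; split=> // F _; rewrite subset0 => ->.
    by rewrite !box_mass0.
  - move=> A1 A2 [D1 [A1D1 mQ1 F1]] [D2 [A2D2 mQ2 F2]]; exists (D1 `|` D2).
    have QU : Q (D1 `|` D2) = Q D1 `|` Q D2.
      apply/seteqP; split=> z.
        move=> [[[x h] k] /= [? ? [?|?] ? ?] <-]; [left|right];
        by exists (x, h, k).
      by move=> [|] [[[x h] k] /= [? ? ? ? ?] <-]; exists (x, h, k) => //; split=> //;
        [left|right].
    rewrite QU; split; [exact: setUSS|exact: measurableU|] => F mF FQ.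
    (* Cutting along [Q D1] leaves a remainder inside [Q D2] and counts nothing twice. *)
    rewrite (@box_mass_split _ _ _ _ act act_continuous nu lam T K C F (Q D1)) //.
    rewrite (@box_mass_split _ _ _ _ act act_continuous nu lam T' K' C' F (Q D1)) //.
    congr (_ + _)%E.
      by apply: F1; [exact: measurableI|exact: subIsetr].
    apply: F2; first exact: measurableD.
    by move=> z [Fz nQ1]; have [] := FQ z Fz.
  - by move=> A1 A2 A12 [D' [AD mQ FQ]]; exists D'; split=> //; exact: subset_trans AD.
  - move=> g _.
    have [N1 gN1 N1B] := lie_small_nbhs cD1 (mulgV g) B1.
    have [N2 gN2 N2B] := lie_small_nbhs cD2 (mulVg g) B1'.
    have [W gW [cW WN]] := lie_locally_compact (filterI gN1 gN2).
    exists W => //; exists W; split=> //.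
      by apply: compact_borel => //; exact: box_transition_compact.
    move=> F mF FQ.
    apply: (box_mass_holonomy actP act_continuous nuP lamP b b' injT _ injT') => //.
    + exact: nbhs_singleton B1.
    + exact: nbhs_singleton B1'.
    + exact: cW.
    + by move=> k k' /WN[N1k _] /WN[N1k' _]; exact: (N1B k k').
    + by move=> k k' /WN[_ N2k] /WN[_ N2k']; exact: (N2B k k').
    + exact: FQ.
move=> [D' [DD' mQ FQ]]; apply: FQ => // z Ez.
have [[x h] /= [Kx Ch] zE] := EKC z Ez.
have [[x' h'] /= [Kx' Ch'] zE'] := EKC' z Ez.
have xk : act x (h * h'^-1)%g = x' by rewrite -(actM actP) zE -zE' (actK actP).
exists (x, h, (h * h'^-1)%g) => //; split=> //=.
- by apply: DD'; exists (h, h').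
- by rewrite xk.
- by rewrite invgM invgK -mulgA mulVg mulg1.
Qed.

End BoxMassEq.

(** * Covers by compact boxes, and a charged box *)

Section BoxCover.
Context {R : realType} {n : nat} {G : lieGroupType R n} {M : pmetricType R}.
Variable act : M -> G -> M.
Hypothesis compactM : compact [set: M].
Hypothesis actP : right_action act.
Implicit Types (T K N : set M) (B C : set G).

Let hausM : hausdorff_space M. Proof. exact: (@metric_hausdorff R M). Qed.
Let hausG : hausdorff_space G. Proof. exact: lie_hausdorff. Qed.

Lemma closed_nbhs (z : M) (U : set M) : nbhs z U ->
  exists2 N, nbhs z N & compact N /\ N `<=` U.
Proof.
move=> zU; have [N zN NU] := compact_regular hausM compactM (@filterT _ (nbhs z) _) zU.
exists (closure N); first by apply: filterS zN; exact: subset_closure.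
split=> //; apply: (subclosed_compact _ compactM) => //; exact: closed_closure.
Qed.

(** [K] and [C] are the coordinate projections of [N]. The last clause holds because a point x of
    [T] has coordinates (x, 1); it serves to exhaust [T] by compact bases. *)
Lemma flow_box_sub T B N : flow_box act T B -> compact N -> N `<=` saturate act T B ->
  exists K C, [/\ compact K, compact C, K `<=` T, C `<=` B &
    N `<=` saturate act K C /\ N `&` T `<=` [set x | B 1%g -> K x]].
Proof.
move=> [_ [h [[_ hTB hK hK'] [_ ch]]]] cN NS.
have chN : compact (h @` N).
  apply: continuous_compact cN; exact: continuous_subspaceW ch.
exists (fst @` (h @` N)), (snd @` (h @` N)); split.
- by apply: continuous_compact chN; apply: continuous_subspaceT => p; exact: cvg_fst.
- by apply: continuous_compact chN; apply: continuous_subspaceT => p; exact: cvg_snd.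
- by move=> _ [_ [z Nz <-] <-]; have [] := hTB z (NS z Nz).
- by move=> _ [_ [z Nz <-] <-]; have [] := hTB z (NS z Nz).
- split=> [z Nz|x [Nx Tx] /= B1].
    exists (h z); last by have := hK' z (mem_set (NS z Nz)).
    by split; exists (h z) => //; exists z.
  have := hK (x, 1%g) (mem_set (conj Tx B1)); rewrite /= (act1 actP) => hx.
  by exists (h x); [exists x|rewrite hx].
Qed.

Lemma act_injectiveS T B K C : act_injective act T B -> K `<=` T -> C `<=` B ->
  act_injective act K C.
Proof.
move=> injT KT CB x y g h Kx Ky Cg Ch; apply: injT;
by [exact: KT|exact: KT|exact: CB|exact: CB].
Qed.

Lemma lamination_box_cover : lamination act ->
  exists s : seq (set M * set M * set G),
    (forall b, b \in s -> is_box act b.1.1 b.1.2 b.2) /\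
    forall z, exists2 b, b \in s & saturate act b.1.2 b.2 z.
Proof.
move=> [B Bball [k [T [Tbox Tcov]]]].
pose P (A : set M) := exists s : seq (set M * set M * set G),
    (forall b, b \in s -> is_box act b.1.1 b.1.2 b.2) /\
    forall z, A z -> exists2 b, b \in s & saturate act b.1.2 b.2 z.
suff [s [sb sc]] : P setT by exists s; split=> // z; exact: sc.
apply: compact_induction compactM _ _ _ _.
- by exists [::]; split.
- move=> A1 A2 [s1 [b1 c1]] [s2 [b2 c2]]; exists (s1 ++ s2); split=> [b|z].
    by rewrite mem_cat => /orP[]; [exact: b1|exact: b2].
  move=> [/c1|/c2] [b bs bz]; exists b => //; rewrite mem_cat bs ?orbT //.
- by move=> A1 A2 A12 [s [sb sc]]; exists s; split=> // z /A12; exact: sc.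
move=> z _; have [i _ zi] : (\bigcup_i saturate act (T i) B) z by rewrite Tcov.
have [N zN [cN NS]] := closed_nbhs (open_nbhs_nbhs (conj (Tbox i).1 zi)).
have [K [C [cK cC KT CB [NKC _]]]] := flow_box_sub (Tbox i) cN NS.
exists N => //; exists [:: (T i, K, C)]; split=> [b|y Ny]; last first.
  by exists (T i, K, C); [rewrite inE|exact: NKC].
rewrite inE => /eqP ->; split=> //=; first by exists B.
exact: act_injectiveS (flow_box_injective (Tbox i)) KT CB.
Qed.

Variable nu : set M -> {measure set (borel M) -> \bar R}.
Hypothesis nuP : transverse_invariant_measure act nu.
Variable lam : {measure set (borel G) -> \bar R}.
Hypothesis lamP : left_haar lam.

Lemma open_sigma_compact (U : set M) : open U ->
  exists N : nat -> set M, (forall l, compact (N l) /\ N l `<=` U) /\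
    U `<=` \bigcup_l N l.
Proof.
move=> oU; pose e (l : nat) : R := l.+1%:R^-1.
have e0 l : 0 < e l by rewrite invr_gt0.
pose N l := closure [set z | ball z (e l) `<=` U].
exists N; split=> [l|x Ux].
  split.
    by apply: (subclosed_compact _ compactM) => //; exact: closed_closure.
  (* A limit of points whose balls of radius [e l] lie in [U] belongs to one of these balls. *)
  move=> z /(_ (ball z (e l)) (nbhsx_ballx _ _ (e0 l))) [y [yU zy]].
  by apply: yU; exact: ball_sym.
have /nbhs_ballP[d /= d0 dU] : nbhs x U by exact: open_nbhs_nbhs.
have [l _ ld] := near_infty_natSinv_lt (PosNum d0).
exists l => //; apply: subset_closure => /= y xy; apply: dU.
by apply: le_ball xy; exact/ltW/(ld l)/leqnn.
Qed.

(** The measure of [T] is nonzero but may be infinite. Exhausting the open flow box by compact sets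
    writes [T] as a countable union of compact bases, one of which must be charged. *)
Lemma charged_box : exists T K C,
  [/\ is_box act T K C, nu T K != 0%E & lam C != 0%E].
Proof.
have [[T tT nuT] _ _] := nuP; have [B Bball Tbox] := tT.
have B1 := identity_ball_nbhs Bball.
have [N [NP Ncov]] := open_sigma_compact Tbox.1.
have [C C1 [cC CB]] := lie_locally_compact B1.
have mC : measurable (C : set (borel G)) by exact: compact_borel.
have KP l : exists K, [/\ compact K, K `<=` T & N l `&` T `<=` K].
  have [cN NS] := NP l; have [K [_ [cK _ KT _ [_ NK]]]] := flow_box_sub Tbox cN NS.
  by exists K; split=> // x /NK; apply; exact: nbhs_singleton B1.
pose K l := projT1 (cid (KP l)).
have KE l : [/\ compact (K l), K l `<=` T & N l `&` T `<=` K l] by exact: (projT2 (cid (KP l))).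
have mK l : measurable (K l : set (borel M)) by have [cK _ _] := KE l; exact: compact_borel.
have TE : T = \bigcup_l K l.
  apply/seteqP; split=> [x Tx|x [l _ Klx]]; last by have [_ + _] := KE l; apply.
  have [|l _ Nlx] := Ncov x.
    by exists (x, 1%g); [split=> //; exact: nbhs_singleton B1|exact: act1].
  by exists l => //; have [_ _] := KE l; apply.
have [l Kl0] : exists l, nu T (K l) != 0%E.
  apply: contrapT => /forallNP K0; move/negP: nuT; apply.
  rewrite -measure_le0 [X in (nu T X <= _)%E]TE.
  apply: le_trans (measure_sigma_subadditive (nu T) mK _ (@subset_refl _ _)) _.
    exact: bigcup_measurable.
  by rewrite eseries0 // => i _ _; apply/eqP/negPn/negP/K0.
have [cK KT _] := KE l.
exists T, (K l), C; split=> //; last exact: (haar_nbhs_neq0 lamP).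
split=> //; exact: act_injectiveS (flow_box_injective Tbox) KT CB.
Qed.

End BoxCover.

(** * Total mass and unimodularity *)

Section TotalMass.
Context {R : realType} {n : nat} {G : lieGroupType R n} {M : pmetricType R}.
Variable act : M -> G -> M.
Hypothesis actP : right_action act.
Hypothesis act_continuous : continuous (fun p : M * G => act p.1 p.2).
Variable nu : set M -> {measure set (borel M) -> \bar R}.
Hypothesis nuP : transverse_invariant_measure act nu.
Variable lam : {sigma_finite_measure set (borel G) -> \bar R}.
Hypothesis lamP : left_haar lam.
Implicit Types (T K E : set M) (C : set G).

Let hausM : hausdorff_space M. Proof. exact: (@metric_hausdorff R M). Qed.
Let hausG : hausdorff_space G. Proof. exact: lie_hausdorff. Qed.
Local Notation box_mass := (box_mass act nu lam).

Definition borel_partition k (P : 'I_k -> set M) : Prop :=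
  [/\ forall i, measurable (P i : set (borel M)), trivIset setT P
    & \bigcup_i P i = setT].

Lemma box_mass_partition k (P : 'I_k -> set M) T K C E :
  borel_partition P -> compact K -> compact C -> measurable (E : set (borel M)) ->
  (box_mass T K C E = \sum_(j < k) box_mass T K C (E `&` P j))%E.
Proof.
move=> [mP tP cP] cK cC mE.
have mEP j : measurable (E `&` P j : set (borel M)) by exact: measurableI.
apply: box_mass_sum => // x.
rewrite -measure_bigsetU_ord.
- congr (lam _); rewrite -bigcup_seq_cond; apply/seteqP; split=> h.
    move=> [Kx Ch Eh]; have [j _ Pj] : (\bigcup_j P j) (act x h) by rewrite cP.
    by exists j => //=; rewrite mem_index_enum.
  by move=> [j _ [Kx Ch []]].
- by move=> j; exact: measurable_box_section.
- apply/trivIsetP => i j _ _ ij; apply/seteqP; split=> // h [[_ _ [_ Pi]] [_ _ [_ Pj]]].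
  have /trivIsetP/(_ i j Logic.I Logic.I ij) := tP.
  by rewrite predeqE => /(_ (act x h))[+ _]; apply.
Qed.

(** Both sums equal the sum over the common refinement by the intersections of P i with P' j, each
    of which lies in a box of either family. *)
Lemma total_mass_eq k (T K T' K' P P' : 'I_k -> set M) (C C' : 'I_k -> set G) :
  borel_partition P -> borel_partition P' ->
  (forall i, is_box act (T i) (K i) (C i)) ->
  (forall i, is_box act (T' i) (K' i) (C' i)) ->
  (forall i, P i `<=` saturate act (K i) (C i)) ->
  (forall i, P' i `<=` saturate act (K' i) (C' i)) ->
  (\sum_(i < k) box_mass (T i) (K i) (C i) (P i) =
   \sum_(i < k) box_mass (T' i) (K' i) (C' i) (P' i))%E.
Proof.
move=> pP pP' b b' PS PS'; have [mP _ _] := pP; have [mP' _ _] := pP'.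
transitivity (\sum_(i < k) \sum_(j < k) box_mass (T i) (K i) (C i) (P i `&` P' j))%E.
  apply: eq_bigr => i _; have [_ _ cK cC _] := b i.
  exact: box_mass_partition.
rewrite exchange_big /=; apply: eq_bigr => j _.
have [_ _ cK' cC' _] := b' j; rewrite (box_mass_partition (T' j) pP) //.
apply: eq_bigr => i _; rewrite setIC.
apply: (box_mass_eq actP act_continuous nuP lamP (b i) (b' j)).
- exact: measurableI.
- by move=> z [_ Pz]; exact: PS.
- by move=> z [Pz _]; exact: PS'.
Qed.

Lemma translate_box T K C (g : G) : is_box act T K C ->
  is_box act T K [set h | C (h * g)%g].
Proof.
move=> [tT KT cK cC injK]; split=> //.
  rewrite (_ : [set h | C (h * g)%g] = [set (h * g^-1)%g | h in C]).
    apply: continuous_compact cC; apply: continuous_subspaceT.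
    exact: lie_rmul_continuous.
  apply/seteqP; split=> [h Ch|_ [h Ch <-] /=]; last by rewrite -mulgA mulVg mulg1.
  by exists (h * g)%g => //; rewrite -mulgA mulgV mulg1.
move=> x y h k Kx Ky Ch Ck e.
have [|xy /(congr1 (fun h => h * g^-1)%g)] := injK x y (h * g)%g (k * g)%g Kx Ky Ch Ck.
  by rewrite -!(actM actP) e.
by rewrite -!mulgA mulgV !mulg1.
Qed.

Lemma act_translate_continuous (g : G) : continuous (act^~ g).
Proof.
move=> x; apply: (@continuous_comp _ _ _ (fun x => (x, g)) (fun p => act p.1 p.2)).
  by apply: cvg_pair; [exact: cvg_id|exact: cvg_cst].
exact: act_continuous.
Qed.

Lemma translate_partition k (P : 'I_k -> set M) (g : G) :
  borel_partition P -> borel_partition (fun i => act^~ g @^-1` P i).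
Proof.
move=> [mP tP cP]; split.
- move=> i; rewrite -[X in measurable X]setTI.
  exact: (@measurable_borel_continuous M M _ (@act_translate_continuous g)).
- apply/trivIsetP => i j _ _ ij; apply/seteqP; split=> // h [Pi Pj].
  have /trivIsetP/(_ i j Logic.I Logic.I ij) := tP.
  by rewrite predeqE => /(_ (act h g))[+ _]; apply.
- apply/seteqP; split=> // z _.
  have [i _ Pi] : (\bigcup_i P i) (act z g) by rewrite cP.
  by exists i.
Qed.

Lemma nu_compact T K C : is_box act T K C -> (nu T K < +oo)%E.
Proof. by move=> [tT KT cK _ _]; have [_ + _] := nuP; apply. Qed.

(** The summand of the function s: the base variable is integrated first. The repeated intersection
    with [K] matches the restriction of [nu T] to [K], a finite measure to which Tonelli's theorem
    applies. *)
Definition slice_mass T K C E (h : borel G) : \bar R :=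
  nu T ([set x | [/\ K x, C h & E (act x h)]] `&` K).

Lemma slice_mass_integral T K C E : is_box act T K C ->
  measurable (E : set (borel M)) ->
  measurable_fun setT (slice_mass T K C E) /\
  (\int[lam]_h slice_mass T K C E h = box_mass T K C E)%E.
Proof.
move=> b mE; have [_ _ cK cC _] := b.
have mK : measurable (K : set (borel M)) by exact: compact_borel.
pose m : {finite_measure set (borel M) -> \bar R} := mfrestr mK (nu_compact b).
pose S : set (borel M * borel G) := [set p | [/\ K p.1, C p.2 & E (act p.1 p.2)]].
have mS : measurable S by exact: (measurable_box_set act_continuous cK cC mE).
have sE h : slice_mass T K C E h = m (ysection S h).
  rewrite /slice_mass /m /= /mfrestr /mrestr; congr (nu T (_ `&` _)).
  by apply/seteqP; split=> x; rewrite ysectionP.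
split.
  rewrite (_ : slice_mass T K C E = m \o ysection S); last exact/funext.
  exact: measurable_fun_ysection.
pose f (p : borel M * borel G) : \bar R := (\1_S p)%:E.
have mf : measurable_fun setT f.
  by apply/measurable_EFinP; exact: measurable_indic.
have f0 p : (0 <= f p)%E by rewrite lee_fin.
have F := @fubini_tonelli _ _ _ _ _ m lam f mf f0.
transitivity (\int[lam]_h \int[m]_x f (x, h))%E.
  apply: eq_integral => h _; rewrite sE.
  transitivity (\int[m]_x (\1_(ysection S h) x)%:E)%E.
    by rewrite integral_indic // ?setIT //; exact: measurable_ysection.
  by apply: eq_integral => x _; rewrite /f !indicE mem_ysection.
apply: (etrans (esym F)).
transitivity (\int[m]_x lam (box_section act K C E x))%E.
  apply: eq_integral => x _.
  have mx := measurable_box_section act_continuous x cK cC mE.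
  transitivity (\int[lam]_h (\1_(box_section act K C E x) h)%:E)%E.
    by apply: eq_integral => h _; rewrite /f !indicE box_sectionE mem_xsection.
  by rewrite integral_indic // setIT.
transitivity (\int[m]_(x in K) lam (box_section act K C E x))%E.
  rewrite [RHS]integral_mkcond; apply: eq_integral => x _.
  rewrite /patch; case: ifPn => // /negP nK.
  rewrite (_ : box_section _ _ _ _ _ = set0) ?measure0 //.
  by apply/seteqP; split=> // h [Kx _ _]; apply: nK; exact/mem_set.
apply: eq_measure_integral => A mA AK.
by rewrite /m /= /mfrestr /mrestr setIidl.
Qed.

(* By right translation, the slices at h g are slices at h of the box with
   plaques C g^-1. *)
Lemma total_slice_mass k (T K P : 'I_k -> set M) (C : 'I_k -> set G) (g : G) :
  borel_partition P -> (forall i, is_box act (T i) (K i) (C i)) ->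
  (forall i, P i `<=` saturate act (K i) (C i)) ->
  (\int[lam]_h \sum_(i < k) slice_mass (T i) (K i) (C i) (P i) (h * g)%g =
   \sum_(i < k) box_mass (T i) (K i) (C i) (P i))%E.
Proof.
move=> pP b PS.
have pPg := translate_partition g pP; have [mPg _ _] := pPg.
have bg i := translate_box g (b i).
have sE i h : slice_mass (T i) (K i) (C i) (P i) (h * g)%g =
    slice_mass (T i) (K i) [set h | C i (h * g)%g] (act^~ g @^-1` P i) h.
  rewrite /slice_mass; congr (nu _ (_ `&` _)); apply/seteqP; split=> x /=;
  by rewrite (actM actP).
rewrite [LHS](_ : _ = \int[lam]_h \sum_(i < k) slice_mass (T i) (K i)
    [set h | C i (h * g)%g] (act^~ g @^-1` P i) h)%E; last first.
  by apply: eq_integral => h _; apply: eq_bigr => i _; exact: sE.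
rewrite ge0_integral_sum //; last first.
  by move=> i; exact: (slice_mass_integral (bg i) (mPg i)).1.
transitivity (\sum_(i < k) box_mass (T i) (K i) [set h | C i (h * g)%g]
    (act^~ g @^-1` P i))%E.
  by apply: eq_bigr => i _; exact: (slice_mass_integral (bg i) (mPg i)).2.
apply: total_mass_eq => // i z /PS [[x h] /= [Kx Ch] e].
exists (x, (h * g^-1)%g) => /=.
  by split=> //=; rewrite -mulgA mulVg mulg1.
by rewrite -(actM actP) e (actK actP).
Qed.

(** Compact bases and plaques have finite measure; the total mass has to be finite to be cancelled
    at the end. *)
Lemma box_mass_lty T K C E : is_box act T K C -> measurable (E : set (borel M)) ->
  (box_mass T K C E < +oo)%E.
Proof.
move=> b mE; have [_ _ cK cC _] := b; have [_ lamK _] := lamP.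
have mK : measurable (K : set (borel M)) by exact: compact_borel.
have mC : measurable (C : set (borel G)) by exact: compact_borel.
apply: (@le_lt_trans _ _ (\int[nu T]_(x in K) (cst (lam C)) x)%E).
  apply: ge0_le_integral_nomeas => x _; first exact: measure_ge0.
  apply: le_measure; rewrite ?inE //; first exact: measurable_box_section.
  by move=> h [].
by rewrite integral_cst // lte_mul_pinfty // ?ge0_fin_numE // ?lamK // (nu_compact b).
Qed.

Lemma box_mass_full T K C : is_box act T K C -> nu T K != 0%E -> lam C != 0%E ->
  (0 < box_mass T K C (saturate act K C))%E.
Proof.
move=> b nK lC; have [_ _ cK cC _] := b.
have mK : measurable (K : set (borel M)) by exact: compact_borel.
have -> : (box_mass T K C (saturate act K C) = \int[nu T]_(x in K) cst (lam C) x)%E.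
  apply: eq_integral => x /set_mem Kx.
  congr (lam _); apply/seteqP; split=> [h []//|h Ch].
  by split=> //; exists (x, h).
by rewrite integral_cst // mule_gt0 // lt0e ?nK ?lC measure_ge0.
Qed.

End TotalMass.

Lemma disjointed_partition (R : realType) (M : pmetricType R) k (D : 'I_k -> set M) :
  (forall i, measurable (D i : set (borel M))) -> \bigcup_i D i = setT ->
  borel_partition (fun i => D i `\` \bigcup_(j in [set j : 'I_k | (j < i)%N]) D j).
Proof.
move=> mD cD; split.
- move=> i; apply: measurableD => //; apply: countable_bigcup_measurable.
    exact/finite_set_countable/finite_finset.
  by move=> j _; exact: mD.
- have disj (i j : 'I_k) : (i < j)%N -> (D i `\` \bigcup_(l in [set l : 'I_k | (l < i)%N]) D l) `&`
      (D j `\` \bigcup_(l in [set l : 'I_k | (l < j)%N]) D l) = set0.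
    move=> ij; apply/seteqP; split=> // z [[Di _] [_ nD]]; apply: nD.
    by exists i.
  apply/trivIsetP => i j _ _; rewrite neq_ltn => /orP[]; first exact: disj.
  by rewrite setIC; exact: disj.
- apply/seteqP; split=> // z _.
  have [i0 _ Di0] : (\bigcup_i D i) z by rewrite cD.
  have [i /asboolP Di imin] := @arg_minnP _ i0 (fun i => `[< D i z >]) (fun i => i : nat)
    (asboolT Di0).
  exists i => //; split=> // -[j /= ji Dj].
  by have := imin j (asboolT Dj); rewrite leqNgt ji.
Qed.

Theorem theorem3 (R : realType) (n : nat) (G : lieGroupType R n)
  (M : pmetricType R) (act : M -> G -> M)
  (compactM : compact [set: M])
  (actP : right_action act)
  (act_continuous : continuous (fun p : M * G => act p.1 p.2))
  (act_locally_free : locally_free act)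
  (actF : lamination act)
  (has_nu : exists nu, transverse_invariant_measure act nu) :
  unimodular G.
Proof.
move=> mu muP; pose lam := sigma_finite_haar muP.
have lamP : left_haar lam by exact: muP.
suff : right_invariant lam by [].
have [nu nuP] := has_nu.
have hausM : hausdorff_space M by exact: (@metric_hausdorff R M).
have [s [sb sc]] := lamination_box_cover compactM actP actF.
have [T0 [K0 [C0 [b0 nK0 lC0]]]] := charged_box compactM actP nuP lamP.
(* The charged box goes first: each point is assigned to the first box containing it, so this box
   stays whole in the partition and makes [c] positive. *)
pose bs := (T0, K0, C0) :: s; pose k := (size s).+1.
pose b (i : 'I_k) := nth (T0, K0, C0) bs i.
pose T i := (b i).1.1; pose K i := (b i).1.2; pose C i := (b i).2.
have bP i : is_box act (T i) (K i) (C i).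
  have : b i \in bs by exact: mem_nth.
  by rewrite /T /K /C; rewrite inE => /orP[/eqP -> //|]; exact: sb.
pose D i := saturate act (K i) (C i).
have mD i : measurable (D i : set (borel M)).
  have [_ _ cK cC _] := bP i; apply: compact_borel => //.
  apply: continuous_compact; last exact: compact_setX.
  by apply: continuous_subspaceT => p; exact: act_continuous.
have cD : \bigcup_i D i = setT.
  apply/seteqP; split=> // z _; have [c cs cz] := sc z.
  have ik : (index c bs < k)%N by rewrite index_mem inE cs orbT.
  exists (Ordinal ik) => //; rewrite /D /K /C /b /= nth_index //.
  by rewrite inE cs orbT.
pose P i := D i `\` \bigcup_(j in [set j : 'I_k | (j < i)%N]) D j.
have pP : borel_partition P by exact: disjointed_partition.
have PS i : P i `<=` D i by exact: subDsetl.
have [mP _ _] := pP.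
pose c := (\sum_(i < k) box_mass act nu lam (T i) (K i) (C i) (P i))%E.
have m0 i : (0 <= box_mass act nu lam (T i) (K i) (C i) (P i))%E by exact: box_mass_ge0.
have P0 : P ord0 = D ord0.
  by rewrite /P (_ : \bigcup_(j in _) D j = set0) ?setD0 // bigcup0.
have c0 : (0 < c)%E.
  apply: (@lt_le_trans _ _ (box_mass act nu lam (T ord0) (K ord0) (C ord0) (P ord0))).
    by rewrite P0; apply: box_mass_full.
  by rewrite /c (bigD1 ord0) //= leeDl // sume_ge0.
have cfin : (c < +oo)%E.
  by apply: lte_sum_pinfty => i _; exact: box_mass_lty.
have cE : c = (fine c)%:E by rewrite fineK // ge0_fin_numE // ltW.
apply: (haar_right_invariant lamP) => A mA.
apply: (haar_inv lamP (s := fun h => (\sum_(i < k) slice_mass act nu (T i) (K i) (C i) (P i) h)%E)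
  (c := fine c)) => //.
- apply: emeasurable_sum => i _.
  exact: (slice_mass_integral act_continuous nuP lam (bP i) (mP i)).1.
- by move=> h; apply: sume_ge0 => i _; exact: measure_ge0.
- by rewrite fine_gt0 // c0.
- by move=> g; rewrite -cE; exact: total_slice_mass.
Qed.
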